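(* Suppose that the Basic Assumptions (a)-(c) hold with constants $f_{\mathrm{low}}$, $L_1>0$, $\sigma>0$, $\alpha\in(1,2]$, and that the Weakly Average Smoothness Assumption holds with $L>0$. Define $$M_\alpha := 2\big(f(x^0) - f_{\mathrm{low}}+\sigma^\alpha+ L_1/2 + 2^{1/(\alpha-1)}(\alpha-1)(2/\alpha)^{\alpha/(\alpha-1)} + 12(L_1^\alpha+L^\alpha) + 12\sigma^\alpha\big).$$ Let $\{x^k\}$ be generated by the normalized SFOM with recursive momentum with input parameters $$\eta_k= \theta_k=\frac{1}{(k+1)^{\alpha/(2\alpha-1)}}\qquad\forall k\ge0.$$ Then, for any $\epsilon \in (0,1)$, it holds that $\mathbb{E}[\|\nabla f(x^{\iota_K})\|]\le \epsilon$ for all integers $K$ satisfying $$K\ge\max\Big\{\Big(\frac{2(2\alpha-1)M_{\alpha}}{(\alpha-1)\epsilon}\ln\Big(\frac{2(2\alpha-1)M_{\alpha}}{(\alpha-1)\epsilon}\Big)\Big)^{(2\alpha-1)/(\alpha-1)},3\Big\},$$ where $\iota_K$ is uniformly drawn from $\{0,\ldots,K-1\}$.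
   Context: Setting. $\|\cdot\|$ is the Euclidean norm on $\mathbb{R}^n$. The function $f:\mathbb{R}^n\to\mathbb{R}$ is continuously differentiable and the problem $\min_{x\in\mathbb{R}^n} f(x)$ has at least one optimal solution. $\xi$ is a random variable with sample space $\Xi$, and $G:\mathbb{R}^n\times\Xi\to\mathbb{R}^n$ is a stochastic gradient estimator. Basic Assumptions. (a) There is a finite $f_{\mathrm{low}}$ with $f(x)\ge f_{\mathrm{low}}$ for all $x\in\mathbb{R}^n$. (b) There is $L_1>0$ with $\|\nabla f(x)-\nabla f(y)\|\le L_1\|x-y\|$ for all $x,y\in\mathbb{R}^n$. (c) $\mathbb{E}[G(x;\xi)]=\nabla f(x)$ and $\mathbb{E}[\|G(x;\xi)-\nabla f(x)\|^\alpha]\le\sigma^\alpha$ for all $x\in\mathbb{R}^n$, for some $\sigma>0$ and $\alpha\in(1,2]$. Weakly Average Smoothness Assumption. There is $L>0$ such that $\mathbb{E}[\|G(x;\xi)-G(y;\xi)\|^\alpha]\le L^\alpha\|x-y\|^\alpha$ for all $x,y\in\mathbb{R}^n$, with the same $\alpha$ as in (c). Normalized SFOM with recursive momentum. Input: a starting point $x^0\in\mathbb{R}^n$, step sizes $\{\eta_k\}_{k\ge0}\subset(0,+\infty)$, weights $\{\theta_k\}_{k\ge0}\subset(0,1]$. Initialize $x^{-1}=x^0$, $m^{-1}=0$, $\theta_{-1}=1$. For $k=0,1,2,\ldots$: $m^k=(1-\theta_{k-1})m^{k-1}+G(x^k;\xi^k)-(1-\theta_{k-1})G(x^{k-1};\xi^k)$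 and $x^{k+1}=x^k-\eta_k m^k/\|m^k\|$, where $\{\xi^k\}$ is a sequence of independently drawn samples of $\xi$. The iteration is understood to be well defined, i.e. $m^k\ne0$ for all $k$. The index $\iota_K$ is drawn independently of the algorithm's samples, so $\mathbb{E}[\|\nabla f(x^{\iota_K})\|]=\frac1K\sum_{k=0}^{K-1}\mathbb{E}[\|\nabla f(x^k)\|]$. *)

(* Defs.v *)
From HB Require Import structures.
From mathcomp Require Import all_boot all_order all_algebra.
From mathcomp Require Import all_classical all_reals all_analysis.

Set Implicit Arguments.
Unset Strict Implicit.
Unset Printing Implicit Defensive.

Import Order.TTheory GRing.Theory Num.Theory.
Import numFieldNormedType.Exports.

Local Open Scope classical_set_scope.
Local Open Scope ring_scope.

(* The library norm `|x| on 'rV[R]_n is the max norm. *)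
Definition enorm (R : realType) (n : nat) (x : 'rV[R]_n) : R :=
  Num.sqrt (\sum_(i < n) x ord0 i ^+ 2).

Definition grad (R : realType) (n : nat) (f : 'rV[R]_n -> R) (x : 'rV[R]_n) :
  'rV[R]_n := \row_(i < n) 'D_(delta_mx ord0 i) f x.

Definition continuously_differentiable (R : realType) (n : nat)
    (f : 'rV[R]_n -> R) : Prop :=
  (forall x, differentiable f x) /\ continuous (grad f).

(* 'rV[R]_n with its Borel sigma-algebra; the library puts no measurable
   structure on 'rV[R]_n itself. *)
Definition borel_rV (R : realType) (n : nat) :=
  g_sigma_algebraType (@open 'rV[R]_n).

Definition jointly_measurable (R : realType) (n : nat) (d : measure_display)
    (Xi : measurableType d) (G : 'rV[R]_n -> Xi -> 'rV[R]_n) : Prop :=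
  measurable_fun [set: borel_rV R n * Xi]
    (fun p : borel_rV R n * Xi => G p.1 p.2 : borel_rV R n).

Definition bounded_below_by (R : realType) (n : nat) (f : 'rV[R]_n -> R)
    (flow : R) : Prop :=
  forall x, flow <= f x.

Definition lipschitz_gradient (R : realType) (n : nat) (f : 'rV[R]_n -> R)
    (L1 : R) : Prop :=
  forall x y, enorm (grad f x - grad f y) <= L1 * enorm (x - y).

(* [D] is the law of the random variable on the sample space [Xi]. The
   expectation of a random vector is taken coordinatewise; 'E_D[_] is
   \bar R-valued, so these statements include finiteness. *)
Definition unbiased (R : realType) (n : nat) (d : measure_display)
    (Xi : measurableType d) (D : probability Xi R) (f : 'rV[R]_n -> R)
    (G : 'rV[R]_n -> Xi -> 'rV[R]_n) : Prop :=
  forall x (i : 'I_n),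
    'E_D[fun z => G x z ord0 i]%E = (grad f x ord0 i)%:E.

Definition central_moment_bound (R : realType) (n : nat) (d : measure_display)
    (Xi : measurableType d) (D : probability Xi R) (f : 'rV[R]_n -> R)
    (G : 'rV[R]_n -> Xi -> 'rV[R]_n) (alpha sigma : R) : Prop :=
  forall x,
    ('E_D[fun z => (enorm (G x z - grad f x) `^ alpha)%R]
       <= (sigma `^ alpha)%:E)%E.

Definition weakly_average_smooth (R : realType) (n : nat) (d : measure_display)
    (Xi : measurableType d) (D : probability Xi R)
    (G : 'rV[R]_n -> Xi -> 'rV[R]_n) (alpha L : R) : Prop :=
  forall x y,
    ('E_D[fun z => (enorm (G x z - G y z) `^ alpha)%R]
       <= ((L `^ alpha * enorm (x - y) `^ alpha)%R)%:E)%E.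

Definition mutually_independent (R : realType) (d d' : measure_display)
    (Omega : measurableType d) (Xi : measurableType d') (P : probability Omega R)
    (X : nat -> Omega -> Xi) : Prop :=
  forall (s : seq nat) (A : nat -> set Xi), uniq s ->
    (forall k, measurable (A k)) ->
    P (\bigcap_(k in [set` s]) (X k @^-1` A k)) =
    (\prod_(k <- s) P (X k @^-1` A k))%E.

Definition iid_samples (R : realType) (d d' : measure_display)
    (Omega : measurableType d) (Xi : measurableType d') (P : probability Omega R)
    (D : probability Xi R) (xi : nat -> {RV P >-> Xi}) : Prop :=
  (forall k A, measurable A -> distribution P (xi k) A = D A) /\
  mutually_independent P xi.

Definition sigma_generated (d d' : measure_display)
    (Omega : measurableType d) (Xi : measurableType d')
    (X : nat -> Omega -> Xi) : set (set Omega) :=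
  <<s \bigcup_k preimage_set_system setT (X k) measurable >>.

Definition independent_of_family (R : realType) (d d' d'' : measure_display)
    (Omega : measurableType d) (Xi : measurableType d') (T : measurableType d'')
    (P : probability Omega R) (Y : Omega -> T) (X : nat -> Omega -> Xi) : Prop :=
  forall (A : set T) (B : set Omega),
    measurable A -> sigma_generated X B ->
    P (Y @^-1` A `&` B) = (P (Y @^-1` A) * P B)%E.

Definition uniform_below (R : realType) (d : measure_display)
    (Omega : measurableType d) (P : probability Omega R) (K : nat)
    (iota : Omega -> nat) : Prop :=
  forall i : nat, (i < K)%N -> P (iota @^-1` [set i]) = (K%:R^-1)%:E.

(* [past a u k] is u_{k-1}, with the convention u_{-1} = a. *)
Definition past (T : Type) (a : T) (u : nat -> T) (k : nat) : T :=
  if k is j.+1 then u j else a.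

Definition nsfom_rm (R : realType) (n : nat) (Omega Xi : Type)
    (G : 'rV[R]_n -> Xi -> 'rV[R]_n) (x0 : 'rV[R]_n) (eta theta : nat -> R)
    (xi : nat -> Omega -> Xi) (x m : nat -> Omega -> 'rV[R]_n) : Prop :=
  forall w : Omega,
  [/\ x 0%N w = x0,
      forall k, m k w =
        (1 - past 1 theta k) *: past 0 (m ^~ w) k + G (x k w) (xi k w)
        - (1 - past 1 theta k) *: G (past x0 (x ^~ w) k) (xi k w)
    & forall k, x k.+1 w = x k w - (eta k / enorm (m k w)) *: m k w].

Definition Malpha (R : realType) (alpha sigma L1 L fx0 flow : R) : R :=
  2 * (fx0 - flow + sigma `^ alpha + L1 / 2
       + 2 `^ (1 / (alpha - 1)) * (alpha - 1)
         * (2 / alpha) `^ (alpha / (alpha - 1))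
       + 12 * (L1 `^ alpha + L `^ alpha) + 12 * sigma `^ alpha).

(* Main.v *)
Require Import Defs.
From HB Require Import structures.
From mathcomp Require Import all_boot all_order all_algebra.
From mathcomp Require Import ring lra.
From mathcomp Require Import all_classical all_reals all_analysis.
From mathcomp Require Import measurable_realfun.

Set Implicit Arguments.
Unset Strict Implicit.
Unset Printing Implicit Defensive.

Import Order.TTheory GRing.Theory Num.Theory.
Import numFieldNormedType.Exports.

Local Open Scope classical_set_scope.
Local Open Scope ring_scope.

(** The proof follows two quantities along the iteration: the function gap
    [f (x k) - flow] and the momentum error [enorm (m k - grad f (x k)) `^ alpha].

    Since the step is normalized, the gap decreases by [eta k] times the gradient
    norm, up to [2 * eta k * enorm (m k - grad f (x k))] and a term of order
    [eta k ^+ 2] ([normalized_step_descent]). On the other side, the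
    vector [m k - grad f (x k)] is multiplied by [1 - theta k] and receives an
    increment that has mean zero given the past. The expansion
    [enorm (a + b) `^ alpha <= enorm a `^ alpha + (linear in b) + 2 * enorm b `^ alpha]
    ([enormD_powR]) therefore gives, in expectation, a contraction by
    [1 - theta k] plus noise of order [eta k `^ alpha] ([momentum_moment_le],
    [momentum_errorS_le]).

    Adding the momentum error to the gap with the weight
    [k.+1%:R `^ ((alpha - 1) ^+ 2 / (2 * alpha - 1))] and splitting the term
    [2 * eta k * enorm (m k - grad f (x k))] by Young's inequality
    ([young_step]), half of the contraction absorbs the error and the other half
    absorbs the growth of the weight ([weight_succ_contract]). All remainders are
    then of order [k.+1%:R^-1], and telescoping ([potential_sum_le]) bounds the
    sum of the expected gradient norms weighted by [eta k] by
    [Malpha * ln K] ([weighted_gradient_sum_le]). Elementary calculus with the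
    condition on [K] concludes ([average_le_of_large]), the random index being
    replaced by the average over all indices ([expectation_uniform_index]).

    Conditioning on the past is replaced by Tonelli's theorem: sample [k + 1] is
    independent of everything determined by the samples up to [k]
    ([past_independent]), so the joint law is a product measure
    ([integral_independent]). Finiteness of the expected gap, error and gradient
    norm is derived along the recursion, from their nonnegativity. *)

(** * Real inequalities *)

Lemma eq_leW d (T : porderType d) (x y : T) : x = y -> (x <= y)%O.
Proof. by move=> ->. Qed.

Section RealInequalities.
Context {R : realType}.
Implicit Types a b c t u : R.

(** Concavity of [u |-> u `^ b] at [1]: this is Young's inequality for the product
    of [u `^ b] and [1], with the conjugate exponents [1 / b] and [1 / (1 - b)]. *)
Lemma powR_le_tangent b u : 0 <= b <= 1 -> 0 <= u ->
  u `^ b <= 1 + b * (u - 1).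
Proof.
move=> /andP[b0 b1] u0.
move: b0 b1; rewrite le_eqVlt => /predU1P[<- _|b0]; first by rewrite powRr0; lra.
rewrite le_eqVlt => /predU1P[->|b1]; first by rewrite powRr1//; lra.
have h : (b^-1)^-1 + ((1 - b)^-1)^-1 = 1 by rewrite !invrK; ring.
have := conjugate_powR (powR_ge0 u b) ler01 _ _ h.
rewrite !invr_gt0 => /(_ b0); rewrite mulr1 powR1 -powRrM divff ?gt_eqF// powRr1//.
by rewrite !invrK subr_gt0 => /(_ b1); lra.
Qed.

(** Convexity at [1], read off from the concave case at the exponent [a^-1] and
    the point [u `^ a]. *)
Lemma powR_ge_tangent a u : 1 <= a -> 0 <= u -> 1 + a * (u - 1) <= u `^ a.
Proof.
move=> a1 u0; have a0 : 0 < a by lra.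
have : u <= 1 + a^-1 * (u `^ a - 1).
  have {1}-> : u = (u `^ a) `^ a^-1.
    by rewrite -powRrM divff ?lt0r_neq0// powRr1.
  by rewrite powR_le_tangent ?powR_ge0// invr_ge0 invf_le1// a1 ltW.
rewrite -(ler_pM2l a0) mulrDr mulrA divff ?gt_eqF//; lra.
Qed.

(** Adding the tangent bounds at the mean [s] of the three numbers makes the
    linear terms cancel; the sharp constant is [3 `^ (a - 1)]. *)
Lemma powR_add3_le a u v w : 1 <= a <= 2 -> 0 <= u -> 0 <= v -> 0 <= w ->
  (u + v + w) `^ a <= 3 * (u `^ a + v `^ a + w `^ a).
Proof.
move=> /andP[a1 a2] u0 v0 w0.
have [s0|s0] := leP (u + v + w) 0.
  have -> : u + v + w = 0 by lra.
  by rewrite powR0 ?gt_eqF ?mulr_ge0 ?addr_ge0 ?powR_ge0//; lra.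
pose s := (u + v + w) / 3.
have sp : 0 < s by rewrite divr_gt0.
have key y : 0 <= y -> s `^ a * (1 + a * (y / s - 1)) <= y `^ a.
  move=> y0.
  have ys : 0 <= y / s by apply: divr_ge0 => //; exact: ltW.
  rewrite -[in leRHS](divfK (lt0r_neq0 sp) y) [leRHS]powRM ?(ltW sp)//.
  by rewrite mulrC ler_wpM2r ?powR_ge0// powR_ge_tangent.
have sumle : 3 * s `^ a <= u `^ a + v `^ a + w `^ a.
  have e : u / s + v / s + w / s = 3.
    by rewrite -!mulrDl /s; field; rewrite gt_eqF.
  have -> : 3 * s `^ a = s `^ a * (1 + a * (u / s - 1)) +
      s `^ a * (1 + a * (v / s - 1)) + s `^ a * (1 + a * (w / s - 1)).
    transitivity (s `^ a * (3 + a * (u / s + v / s + w / s - 3))); last by ring.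
    by rewrite e; ring.
  by apply: lerD; [apply: lerD|]; apply: key.
have -> : u + v + w = 3 * s by rewrite /s; field.
rewrite powRM ?(ltW sp)//.
apply: (@le_trans _ _ (3 ^+ 2 * s `^ a)); last by lra.
by rewrite ler_wpM2r ?powR_ge0// -powR_mulrn// ler_powR//; lra.
Qed.

(** The additive constant is the maximum of [b * t - c * t `^ a] over [t]; it is
    attained at the point [r] of the proof, and the bound is the tangent
    inequality for [t / r]. *)
Lemma young_powR a b c t : 1 < a -> 0 < b -> 0 < c -> 0 <= t ->
  b * t <= c * t `^ a +
    (a - 1) * (b / a) `^ (a / (a - 1)) * c `^ (- (1 / (a - 1))).
Proof.
move=> a1 b0 c0 t0.
have an0 : a != 0 by apply/eqP; lra.
have a1n0 : a - 1 != 0 by apply/eqP; lra.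
pose r := (b / a) `^ (1 / (a - 1)) * c `^ (- (1 / (a - 1))).
have ba : 0 < b / a by rewrite divr_gt0//; lra.
have rp : 0 < r by rewrite mulr_gt0 ?powR_gt0.
have cr : c * r `^ a = b / a * r.
  rewrite -(@mulr_powRB1 _ r a) ?(ltW rp)//; last by lra.
  have -> : r `^ (a - 1) = b / a * c^-1.
    rewrite /r powRM ?powR_ge0// -!powRrM.
    have -> : 1 / (a - 1) * (a - 1) = 1 by field.
    have -> : - (1 / (a - 1)) * (a - 1) = - 1 by field.
    by rewrite powRr1 ?(ltW ba)// powR_inv1 ?(ltW c0).
  by field; rewrite an0 gt_eqF.
have -> : (b / a) `^ (a / (a - 1)) = b / a * (b / a) `^ (1 / (a - 1)).
  have -> : a / (a - 1) = 1 + 1 / (a - 1) by field.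
  rewrite powRD; first by rewrite powRr1 ?(ltW ba).
  by rewrite (gt_eqF ba) implybT.
have -> : (a - 1) * (b / a * (b / a) `^ (1 / (a - 1))) * c `^ (- (1 / (a - 1)))
  = (a - 1) * (b / a * r) by rewrite /r; ring.
have -> : c * t `^ a = b / a * r * (t / r) `^ a.
  rewrite -cr -mulrA -powRM ?divr_ge0 ?(ltW rp)//.
  by rewrite [r * _]mulrC divfK ?(gt_eqF rp).
have h : 1 + a * (t / r - 1) <= (t / r) `^ a.
  by rewrite powR_ge_tangent ?divr_ge0 ?(ltW rp)//; lra.
have br : 0 < b / a * r by rewrite mulr_gt0.
have := h; rewrite -(ler_pM2l br) => {}h.
have -> : b * t = b / a * r * (1 + a * (t / r - 1)) + (a - 1) * (b / a * r).
  by field; rewrite an0 (gt_eqF rp).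
by rewrite lerD2r.
Qed.

Lemma ln3_ge1 : 1 <= ln (3 : R).
Proof.
have h6 : expR (-1) = expR (- (1 / 6) : R) ^+ 6.
  by rewrite -expRM_natl; congr expR; field.
have h : 3^-1 <= expR (-1 : R).
  (* six factors are enough, because (5 / 6) ^ 6 > 1 / 3 *)
  have l : (5 / 6 : R) <= expR (- (1 / 6)).
    by have := expR_ge1Dx (- (1 / 6) : R); lra.
  rewrite h6; apply: (@le_trans _ _ ((5 / 6) ^+ 6)); first lra.
  by rewrite lerXn2r// nnegrE ?expR_ge0//; lra.
have : ln (3^-1 : R) <= ln (expR (-1 : R)).
  by rewrite ler_ln ?posrE ?expR_gt0// invr_gt0.
by rewrite expRK lnV ?posrE//; lra.
Qed.

(** Each term past the first is at most [ln k.+2%:R - ln k.+1%:R], since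
    [ln (1 - 1 / k.+2%:R) <= - 1 / k.+2%:R]. *)
Lemma sum_inv_le_ln (K : nat) : (0 < K)%N ->
  \sum_(k < K) (k.+1%:R^-1 : R) <= 1 + ln K%:R.
Proof.
case: K => // K _; elim: K => [|K IH].
  by rewrite big_ord_recr big_ord0 /= ln1 invr1; lra.
rewrite big_ord_recr /=; apply: (le_trans (lerD IH (lexx _))).
have K2 : (0 : R) < K.+2%:R by rewrite ltr0n.
have K1 : (0 : R) < K.+1%:R by rewrite ltr0n.
have : ln (1 + - K.+2%:R^-1 : R) <= - K.+2%:R^-1.
  apply: le_ln1Dx; rewrite ltrN2 invf_lt1// ltr1n//.
have -> : 1 + - K.+2%:R^-1 = K.+1%:R / K.+2%:R :> R.
  have -> : K.+1%:R = K.+2%:R - 1 :> R by rewrite -[in RHS]natr1 addrK.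
  by rewrite mulrBl divff ?gt_eqF// mul1r.
rewrite lnM ?posrE ?invr_gt0// lnV ?posrE//.
move: (ln K.+1%:R) (ln K.+2%:R) (K.+2%:R^-1) => p q r; lra.
Qed.

(** At [u0 = A * ln A] the claim reads [ln (ln A) <= ln A]. Past [u0] the tangent
    of [ln] at [u0], of slope [u0^-1 <= 2 / A], stays below the right-hand side.
    This is what turns the condition on the number of iterations into a bound
    on [ln u / u]. *)
Lemma ln_le_of_mul_ln_le (A u : R) : 12 <= A -> A * ln A <= u ->
  ln u <= 2 * u / A.
Proof.
move=> A12 hu.
have A0 : 0 < A by lra.
have lnA : 1 <= ln A.
  by apply: (le_trans ln3_ge1); rewrite ler_ln ?posrE//; lra.
have lnA0 : 0 < ln A by lra.
pose u0 := A * ln A.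
have u00 : 0 < u0 by rewrite mulr_gt0.
have u0' : 0 < u by apply: lt_le_trans hu.
have h1 : ln u <= ln u0 + (u / u0 - 1).
  have -> : u = u0 * (1 + (u / u0 - 1)) by field; rewrite gt_eqF.
  rewrite lnM ?posrE//; last by rewrite addrC subrK divr_gt0.
  have -> : u0 * (1 + (u / u0 - 1)) / u0 = u / u0 by field; rewrite gt_eqF.
  rewrite lerD2l le_ln1Dx//; have : 0 < u / u0 by rewrite divr_gt0.
  lra.
have h2 : ln u0 = ln A + ln (ln A) by rewrite lnM ?posrE.
have h3 : ln (ln A) <= ln A by apply/ltW/ln_sublinear.
have h4 : (u / u0) * (2 * ln A - 1) >= 2 * ln A - 1.
  by rewrite ler_peMl ?subr_ge0 ?ler_pdivlMr ?mul1r//; lra.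
have -> : 2 * u / A = (u / u0) * (2 * ln A).
  by rewrite /u0; field; rewrite (gt_eqF A0) (gt_eqF lnA0).
lra.
Qed.

End RealInequalities.

(** * The step-size schedule *)

Section StepSizeSchedule.
Context {R : realType}.
Variable a : R.
Hypotheses (a1 : 1 < a) (a2 : a <= 2).

Ltac alra := have := a1; have := a2; lra.
Implicit Types N r : R.

(** With [N = k + 1], both the step size and the momentum weight of iteration [k]
    are [N `^ (- step_exp)]. *)
Definition step_exp : R := a / (2 * a - 1).

(** The potential is the function gap plus [N `^ weight_exp] times the momentum
    error. This exponent is the one for which the Young remainder
    ([young_step]) and the weighted noise ([weight_noise]) are both of
    order [N^-1], whose sum is logarithmic. *)
Definition weight_exp : R := (a - 1) ^+ 2 / (2 * a - 1).

(** The constant of [young_powR] for [b = 2] and [c = 1 / 2]. *)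
Definition young_const : R :=
  2 `^ (1 / (a - 1)) * (a - 1) * (2 / a) `^ (a / (a - 1)).

Let an0 : a != 0. Proof. by apply: lt0r_neq0; alra. Qed.
Let am1n0 : a - 1 != 0. Proof. by apply: lt0r_neq0; alra. Qed.
Let dpos : 0 < 2 * a - 1. Proof. by alra. Qed.
Let dn0 : 2 * a - 1 != 0. Proof. exact: lt0r_neq0. Qed.

Lemma step_exp_bounds : 2^-1 <= step_exp <= 1.
Proof. by rewrite /step_exp ler_pdivlMr// ler_pdivrMr//; alra. Qed.

Lemma weight_exp_bounds : 0 <= weight_exp <= 2^-1.
Proof.
rewrite /weight_exp divr_ge0 ?sqr_ge0 ?(ltW dpos)//= ler_pdivrMr//.
have : 0 <= (a - 1) * (2 - a) by rewrite mulr_ge0//; alra.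
rewrite expr2; nra.
Qed.

(** With [t = a - 1], Bernoulli's inequality gives [2 `^ (1 / t) >= 1 + 1 / t],
    hence [2 `^ (1 / t) * t >= t + 1]. This keeps the constant of the complexity
    bound away from zero, as [ln_le_of_mul_ln_le] needs. *)
Lemma young_const_ge1 : 1 <= young_const.
Proof.
have inv1 : 1 <= 1 / (a - 1) by rewrite ler_pdivlMr; alra.
have h : (1 : R) <= 2 `^ (1 / (a - 1)) * (a - 1).
  have := powR_ge_tangent inv1 (ler0n R 2).
  have d0 : 0 < a - 1 by alra.
  rewrite -(ler_pM2r d0) => /(le_trans _); apply.
  have -> : (1 + 1 / (a - 1) * (2%:R - 1)) * (a - 1) = a - 1 + (2%:R - 1).
    by field.
  alra.
have a0 : 0 < a by alra.
have h2 : 1 <= (2 / a) `^ (a / (a - 1)).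
  rewrite -{1}(powRr0 (2 / a)) ler_powR//; first by rewrite ler_pdivlMr ?mul1r.
  by apply: divr_ge0; alra.
by rewrite /young_const; apply: (le_trans h); rewrite ler_peMr// (le_trans ler01).
Qed.

(** Young's inequality splits the error term of the descent inequality into half
    of what the contraction of the weighted momentum error absorbs
    ([weight_succ_contract]) and a remainder of order [N^-1]. *)
Lemma young_step N r : 0 < N -> 0 <= r ->
  2 * N `^ (- step_exp) * r <=
  N `^ weight_exp * N `^ (- step_exp) / 2 * r `^ a + young_const * N^-1.
Proof.
move=> N0 r0.
have Nn0 : N != 0 by exact: lt0r_neq0.
have b0 : 0 < 2 * N `^ (- step_exp) by rewrite mulr_gt0 ?powR_gt0.
have c0 : 0 < N `^ weight_exp * N `^ (- step_exp) / 2.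
  by rewrite divr_gt0 ?mulr_gt0 ?powR_gt0.
apply: (le_trans (young_powR a1 b0 c0 r0)); rewrite lerD2l.
apply/eq_leW; rewrite /young_const.
have -> : 2 * N `^ (- step_exp) / a = 2 / a * N `^ (- step_exp) by field.
have ia0 : 0 <= 2 / a by apply: divr_ge0; alra.
rewrite [(_ * N `^ _) `^ _ in LHS](powRM _ ia0) ?powR_ge0//.
rewrite -powRD ?Nn0 ?implybT// [(_ / 2) `^ _]powRM ?powR_ge0 ?invr_ge0//.
have -> : (2 : R)^-1 = 2 `^ (- 1) by rewrite powR_inv1.
rewrite -!powRrM.
have -> : -1 * - (1 / (a - 1)) = 1 / (a - 1) by ring.
have -> : N^-1 = N `^ (- step_exp * (a / (a - 1))) *
    N `^ ((weight_exp - step_exp) * - (1 / (a - 1))).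
  rewrite -powRD ?Nn0 ?implybT// -(powR_inv1 (ltW N0)); congr powR.
  by rewrite /weight_exp /step_exp; field; rewrite dn0 am1n0.
ring.
Qed.

Lemma weight_succ N : 1 <= N ->
  (N + 1) `^ weight_exp <= (1 + weight_exp * N^-1) * N `^ weight_exp.
Proof.
move=> N1; have N0 : 0 < N by alra.
have [w0 w1] := andP weight_exp_bounds.
have -> : N + 1 = (1 + N^-1) * N by field; exact: lt0r_neq0.
have Ni : 0 <= N^-1 by rewrite invr_ge0 ltW.
rewrite powRM ?(ltW N0)//; last by alra.
rewrite ler_wpM2r ?powR_ge0//.
have := @powR_le_tangent _ weight_exp (1 + N^-1).
rewrite addrC addrK; apply; alra.
Qed.

Lemma weight_succ_le2 N : 1 <= N ->
  (N + 1) `^ weight_exp <= 2 * N `^ weight_exp.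
Proof.
move=> N1; apply: (le_trans (weight_succ N1)).
rewrite ler_wpM2r ?powR_ge0//.
have [w0 w1] := andP weight_exp_bounds.
have : weight_exp * N^-1 <= 1 * 1.
  by rewrite ler_pM ?invr_ge0 ?invf_le1//; alra.
alra.
Qed.

(** The growth of the weight is at most a factor [1 + weight_exp / N], and
    [weight_exp / N <= N `^ (- step_exp) / 2], so it uses up only half of the
    contraction factor. *)
Lemma weight_succ_contract N : 1 <= N ->
  (N + 1) `^ weight_exp * (1 - N `^ (- step_exp)) <=
  N `^ weight_exp * (1 - N `^ (- step_exp) / 2).
Proof.
move=> N1; have N0 : 0 < N by alra.
have [w0 w1] := andP weight_exp_bounds.
have [s0 s1] := andP step_exp_bounds.
set th := N `^ _.
have th1 : th <= 1 by rewrite -(powRr0 N) ler_powR; alra.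
have thN : N^-1 <= th by rewrite -(powR_inv1 (ltW N0)) ler_powR; alra.
have Ni : 0 <= N^-1 by rewrite invr_ge0 ltW.
apply: (@le_trans _ _ ((1 + weight_exp * N^-1) * N `^ weight_exp * (1 - th))).
  by rewrite ler_wpM2r ?subr_ge0// weight_succ.
rewrite -mulrA mulrCA ler_wpM2l ?powR_ge0//.
have : weight_exp * N^-1 <= 2^-1 * th by rewrite ler_pM.
have : 0 <= weight_exp * N^-1 by rewrite mulr_ge0.
nra.
Qed.

Lemma weight_noise N : 0 < N ->
  N `^ weight_exp * (N `^ (- step_exp)) `^ a = N^-1.
Proof.
move=> N0; rewrite -powRrM -powRD ?(lt0r_neq0 N0) ?implybT//.
rewrite -(powR_inv1 (ltW N0)); congr powR.
by rewrite /weight_exp /step_exp; field.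
Qed.

Lemma step_sqr_le N : 1 <= N -> (N `^ (- step_exp)) ^+ 2 <= N^-1.
Proof.
move=> N1; have N0 : 0 < N by alra.
rewrite -powR_mulrn ?powR_ge0// -powRrM -(powR_inv1 (ltW N0)) ler_powR//.
have [] := andP step_exp_bounds; alra.
Qed.

(** Telescoping of the potential [F k + k.+1%:R `^ weight_exp * e k]. *)
Lemma potential_sum_le (F e g : nat -> R) (B C : R) :
  (forall k, 0 <= e k) -> 0 <= C ->
  (forall k, F k.+1 + k.+1%:R `^ (- step_exp) * g k <=
     F k + k.+1%:R `^ weight_exp * k.+1%:R `^ (- step_exp) / 2 * e k
     + B * k.+1%:R^-1) ->
  (forall k, e k.+1 <= (1 - k.+1%:R `^ (- step_exp)) * e k
     + C * (k.+1%:R `^ (- step_exp)) `^ a) ->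
  forall K, F K + K.+1%:R `^ weight_exp * e K
      + \sum_(k < K) k.+1%:R `^ (- step_exp) * g k
    <= F 0%N + e 0%N + (B + 2 * C) * \sum_(k < K) k.+1%:R^-1.
Proof.
move=> e0 C0 hF he; elim=> [|K IH].
  by rewrite !big_ord0 powR1 mul1r mulr0.
rewrite !big_ord_recr /=.
pose N : R := K.+1%:R.
have N1 : 1 <= N by rewrite ler1n.
have hN : K.+2%:R = N + 1 by rewrite /N natr1.
have h1 := weight_succ_contract N1.
have {}h1 := ler_wpM2r (e0 K) h1.
have h2 := ler_wpM2r (mulr_ge0 C0 (powR_ge0 (N `^ - step_exp) a)) (weight_succ_le2 N1).
have h3 := ler_wpM2l (powR_ge0 (N + 1) weight_exp) (he K).
have h4 : N `^ weight_exp * (C * (N `^ (- step_exp)) `^ a) = C * N^-1.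
  by rewrite mulrCA weight_noise// (lt_le_trans ltr01).
have h5 := hF K.
rewrite -!/N in h3 h5 IH *; rewrite hN.
move: h1 h2 h3 h4 h5 IH.
set q := N `^ - step_exp; set p := N `^ weight_exp.
set p' := (N + 1) `^ weight_exp; set y := q `^ a; set v := N^-1.
set S1 := \sum_(i < K) _; set S2 := \sum_(i < K) _.
rewrite -[2 * p * _]mulrA => + h2 + h4; rewrite h4 in h2; move: h2.
move: (F K) (F K.+1) (e K) (e K.+1) (g K) => F1 F2 e1 e2 g1.
alra.
Qed.

(** The step sizes decrease, so the last one can be factored out of the weighted
    sum; with [u = K `^ ((a - 1) / (2 * a - 1))] what remains to be shown is
    [M * ln K <= u * eps], where [ln u] is [(a - 1) / (2 * a - 1) * ln K]. *)
Lemma average_le_of_large (M eps : R) (K : nat) (g : nat -> R) :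
  2 <= M -> 0 < eps < 1 ->
  (let A := 2 * (2 * a - 1) * M / ((a - 1) * eps) in
   (A * ln A) `^ ((2 * a - 1) / (a - 1)) <= K%:R) ->
  (3 <= K)%N ->
  (forall k, 0 <= g k) ->
  \sum_(k < K) k.+1%:R `^ (- step_exp) * g k <= M * ln K%:R ->
  \sum_(k < K) g k <= K%:R * eps.
Proof.
move=> M2 /andP[eps0 eps1]; set A := _ / _ => /= hA K3 g0 hS.
have K0 : (0 : R) < K%:R by rewrite ltr0n (leq_trans _ K3).
have Kn0 := lt0r_neq0 K0.
pose s := (a - 1) / (2 * a - 1).
have s0 : 0 < s by rewrite divr_gt0//; alra.
pose u := (K%:R : R) `^ s.
have u0 : 0 < u by rewrite powR_gt0.
have s3 : s * 3 <= 1 by rewrite /s mulrAC ler_pdivrMr//; alra.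
have hAM : A * (s * eps) = 2 * M.
  by rewrite /A /s; field; rewrite dn0 am1n0 gt_eqF.
have se : 0 < s * eps by rewrite mulr_gt0.
have A12 : 12 <= A.
  rewrite -(ler_pM2r se) hAM; have : s * eps <= s * 1 by rewrite ler_wpM2l ?ltW.
  alra.
have lnA0 : 0 <= ln A by apply: ln_ge0; alra.
have uA : A * ln A <= u.
  have AA0 : 0 <= A * ln A by rewrite mulr_ge0//; alra.
  have := ge0_ler_powR (ltW s0) _ _ hA; rewrite -powRrM.
  have -> : (2 * a - 1) / (a - 1) * s = 1 by rewrite /s; field; rewrite dn0.
  by rewrite powRr1//; apply; rewrite nnegrE ?powR_ge0 ?ler0n.
have := ln_le_of_mul_ln_le A12 uA; rewrite ln_powR => hln.
have hM : M * ln K%:R <= u * eps.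
  rewrite -(ler_pM2l s0) mulrCA.
  apply: (@le_trans _ _ (M * (2 * u / A))); first by rewrite ler_wpM2l//; alra.
  have -> : M = A * (s * eps) / 2 by rewrite hAM; field.
  apply/eq_leW; field; apply: lt0r_neq0; alra.
pose h := (K%:R : R) `^ (- step_exp).
have h0 : 0 < h by rewrite powR_gt0.
have hle : h * (\sum_(k < K) g k) <= u * eps.
  apply: le_trans (le_trans hS hM); rewrite mulr_sumr ler_sum// => i _.
  rewrite ler_wpM2r// /h !powRN lef_pV2 ?posrE ?powR_gt0 ?ltr0n ?(leq_trans _ K3)//.
  have [? ?] := andP step_exp_bounds.
  by rewrite ge0_ler_powR ?nnegrE ?ler0n ?ler_nat//; alra.
rewrite -(ler_pM2l h0); apply: (le_trans hle); rewrite mulrA ler_wpM2r ?(ltW eps0)//.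
rewrite -{1}(powRr1 (ltW K0)) /h -powRD ?Kn0 ?implybT//.
apply/eq_leW; congr powR; rewrite /s /step_exp; field; exact: dn0.
Qed.

End StepSizeSchedule.

(** * Euclidean geometry *)

Section EuclideanGeometry.
Context {R : realType} {n : nat}.
Implicit Types (x y z v : 'rV[R]_n) (c : R).

Definition dot x y : R := \sum_(i < n) x ord0 i * y ord0 i.

Lemma dotC x y : dot x y = dot y x.
Proof. by apply: eq_bigr => i _; rewrite mulrC. Qed.

Lemma dotDl x y z : dot (x + y) z = dot x z + dot y z.
Proof. by rewrite -big_split; apply: eq_bigr => i _; rewrite mxE mulrDl. Qed.

Lemma dotZl c x y : dot (c *: x) y = c * dot x y.
Proof. by rewrite mulr_sumr; apply: eq_bigr => i _; rewrite mxE mulrA. Qed.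

Lemma dotDr x y z : dot z (x + y) = dot z x + dot z y.
Proof. by rewrite dotC dotDl !(dotC z). Qed.

Lemma dotZr c x y : dot y (c *: x) = c * dot y x.
Proof. by rewrite dotC dotZl (dotC y). Qed.

Lemma dotNl x y : dot (- x) y = - dot x y.
Proof. by rewrite -scaleN1r dotZl mulN1r. Qed.

Lemma dotNr x y : dot y (- x) = - dot y x.
Proof. by rewrite dotC dotNl (dotC y). Qed.

Lemma dot0l y : dot 0 y = 0.
Proof. by rewrite -(scale0r 0) dotZl mul0r. Qed.

Lemma dotxx_ge0 x : 0 <= dot x x.
Proof. by apply: sumr_ge0 => i _; rewrite -expr2 sqr_ge0. Qed.

Lemma enormE x : enorm x = Num.sqrt (dot x x).
Proof. by congr Num.sqrt; apply: eq_bigr => i _; rewrite expr2. Qed.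

Lemma enorm_ge0 x : 0 <= enorm x.
Proof. exact: sqrtr_ge0. Qed.

Lemma enorm_sqr x : enorm x ^+ 2 = dot x x.
Proof. by rewrite enormE sqr_sqrtr// dotxx_ge0. Qed.

Lemma enorm0 : enorm (0 : 'rV[R]_n) = 0.
Proof.
by rewrite enormE /dot big1 ?sqrtr0// => i _; rewrite mxE mul0r.
Qed.

Lemma enorm_eq0 x : enorm x = 0 -> x = 0.
Proof.
move=> h; have /eqP := enorm_sqr x; rewrite h expr0n eq_sym psumr_eq0 => [/allP|]; last first.
  by move=> i _; rewrite -expr2 sqr_ge0.
move=> x0; apply/rowP => i; rewrite mxE.
have /(_ (mem_index_enum i)) := x0 i; rewrite -expr2 sqrf_eq0.
by move/eqP.
Qed.

Lemma enormZ c x : enorm (c *: x) = `|c| * enorm x.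
Proof.
by rewrite !enormE dotZl dotZr mulrA -expr2 sqrtrM ?sqr_ge0// sqrtr_sqr.
Qed.

Lemma enormN x : enorm (- x) = enorm x.
Proof. by rewrite -scaleN1r enormZ normrN1 mul1r. Qed.

Lemma enormD_sqr x y :
  enorm (x + y) ^+ 2 = enorm x ^+ 2 + 2 * dot x y + enorm y ^+ 2.
Proof. rewrite !enorm_sqr dotDl !dotDr (dotC y x); ring. Qed.

Lemma dot_le x y : dot x y <= enorm x * enorm y.
Proof.
have [p0|p0] := eqVneq (enorm x) 0.
  by rewrite (enorm_eq0 p0) enorm0 mul0r dot0l.
have [q0|q0] := eqVneq (enorm y) 0.
  by rewrite (enorm_eq0 q0) enorm0 mulr0 dotC dot0l.
have p : 0 < enorm x * enorm y by rewrite mulr_gt0// lt_def enorm_ge0 andbT.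
have := sqr_ge0 (enorm (enorm y *: x - enorm x *: y)).
rewrite enormD_sqr enormN !enormZ !ger0_norm ?enorm_ge0// dotNr dotZl dotZr.
by move=> h; rewrite -(ler_pM2l p); lra.
Qed.

Lemma ler_enormD x y : enorm (x + y) <= enorm x + enorm y.
Proof.
rewrite -(@ler_pXn2r _ 2) ?nnegrE ?addr_ge0 ?enorm_ge0//.
by rewrite enormD_sqr sqrrD lerD2r lerD2l mulr2n; have := dot_le x y; lra.
Qed.

Lemma coord_le_enorm x i : `|x ord0 i| <= enorm x.
Proof.
rewrite -sqrtr_sqr ler_sqrt ?sumr_ge0// => [|j _]; last by rewrite sqr_ge0.
by rewrite (bigD1 i)//= lerDl sumr_ge0// => j _; rewrite sqr_ge0.
Qed.

(** A first-order expansion of the [a]-th power of the norm, valid although this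
    power need not have a second derivative at the origin. Expand
    [enorm (x + y) ^+ 2] and use that [s |-> s `^ (a / 2)] is concave, with the
    tangent taken at the square of the larger of the two norms. If [y] is the
    larger one, everything is measured in units of [enorm y], and it remains to
    bound [a * (r `^ (a - 1) - r)] by [1] for [r <= 1]. *)
Lemma enormD_powR (a : R) x y : 1 < a <= 2 ->
  enorm (x + y) `^ a <=
  enorm x `^ a + a * enorm x `^ (a - 2) * dot x y + 2 * enorm y `^ a.
Proof.
move=> /andP[a1 a2].
have a0 : a != 0 by apply: lt0r_neq0; lra.
have [p0|pn0] := eqVneq (enorm x) 0.
  rewrite (enorm_eq0 p0) enorm0 add0r dot0l mulr0.
  by rewrite powR0// !add0r ler_peMl ?powR_ge0//; lra.
have p0 : 0 < enorm x by rewrite lt_def enorm_ge0 pn0.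
move: p0; set p := enorm x => p0; set q := enorm y; set d := dot x y.
have q0 : 0 <= q := enorm_ge0 _.
have dlo : - (p * q) <= d.
  by have := dot_le x (- y); rewrite dotNr enormN -/p -/q -/d; lra.
have half s : 0 <= s -> s `^ a = (s ^+ 2) `^ (a / 2).
  by move=> s0; rewrite -powR_mulrn// -powRrM; congr powR; field.
have sq := enormD_sqr x y.
rewrite -/p -/q -/d in sq.
(* concavity of [t |-> t `^ (a / 2)] at the base point [s ^+ 2] *)
have tangent s : 0 < s -> enorm (x + y) `^ a <=
    s `^ a + a / 2 * s `^ (a - 2) * (p ^+ 2 + 2 * d + q ^+ 2 - s ^+ 2).
  move=> s0; rewrite half ?enorm_ge0// sq.
  have S0 : 0 <= p ^+ 2 + 2 * d + q ^+ 2 by rewrite -sq sqr_ge0.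
  move: S0; set S := _ + q ^+ 2 => S0.
  have s2 : 0 < s ^+ 2 by rewrite exprn_gt0.
  have -> : S = s ^+ 2 * (S / s ^+ 2) by rewrite mulrC divfK// gt_eqF.
  rewrite powRM ?divr_ge0 ?(ltW s2)// -half ?(ltW s0)//.
  have b : 0 <= a / 2 <= 1 by apply/andP; split; lra.
  have u0 : 0 <= S / s ^+ 2 by rewrite divr_ge0// ltW.
  have := ler_wpM2l (powR_ge0 s a) (powR_le_tangent b u0).
  move/le_trans; apply.
  have -> : s `^ (a - 2) = s `^ a / s ^+ 2.
    by rewrite powRB ?(gt_eqF s0) ?implybT// powR_mulrn ?(ltW s0).
  by apply/eq_leW; field; rewrite gt_eqF.
have [qp|pq] := leP q p.
  apply: (le_trans (tangent _ p0)).
  have h : p `^ (a - 2) * q ^+ 2 <= q `^ a.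
    have [->|qn0] := eqVneq q 0; first by rewrite expr0n mulr0 powR_ge0.
    have qp0 : 0 < q by rewrite lt_def qn0.
    have -> : q `^ a = q `^ (a - 2) * q ^+ 2.
      by rewrite -powR_mulrn ?(ltW qp0)// -powRD ?qn0 ?implybT// subrK.
    rewrite ler_wpM2r ?sqr_ge0//.
    have -> : a - 2 = - (2 - a) by ring.
    rewrite !powRN lef_pV2 ?posrE ?powR_gt0//.
    by rewrite ge0_ler_powR ?nnegrE ?(ltW p0)//; lra.
  have := powR_ge0 q a.
  have -> : a / 2 * p `^ (a - 2) * (p ^+ 2 + 2 * d + q ^+ 2 - p ^+ 2) =
    a * p `^ (a - 2) * d + a / 2 * (p `^ (a - 2) * q ^+ 2) by field.
  nra.
have qq0 : 0 < q by apply: lt_trans pq.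
apply: (le_trans (tangent _ qq0)).
pose r := p / q.
have r0 : 0 < r by rewrite divr_gt0.
have r1 : r <= 1 by rewrite ler_pdivrMr// mul1r ltW.
pose c := d / (p * q).
have pE : p = q * r by rewrite /r mulrC divfK// gt_eqF.
have dE : d = q ^+ 2 * (r * c).
  by rewrite /c /r; field; rewrite pn0 gt_eqF.
have c1 : -1 <= c by rewrite ler_pdivlMr ?mulr_gt0// mulN1r.
clearbody c r.
have e1 : q `^ (a - 2) * q ^+ 2 = q `^ a.
  by rewrite -powR_mulrn// -powRD ?(gt_eqF qq0) ?implybT// subrK.
have e2 : r `^ (a - 2) * r = r `^ (a - 1).
  rewrite -{2}(powRr1 (ltW r0)) -powRD ?(gt_eqF r0) ?implybT//.
  by congr powR; ring.
rewrite dE pE !powRM ?(ltW r0)//.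
have -> : a / 2 * q `^ (a - 2) *
    ((q * r) ^+ 2 + 2 * (q ^+ 2 * (r * c)) + q ^+ 2 - q ^+ 2) =
  q `^ a * (a / 2 * r ^+ 2 + a * r * c) by rewrite -e1; field.
have -> : a * (q `^ (a - 2) * r `^ (a - 2)) * (q ^+ 2 * (r * c)) =
  q `^ a * (a * r `^ (a - 1) * c) by rewrite -e1 -e2; ring.
rewrite -{1}[q `^ a]mulr1 [2 * _]mulrC -!mulrDr ler_wpM2l ?powR_ge0//.
have b : 0 <= a - 1 <= 1 by apply/andP; split; lra.
have h1 := powR_le_tangent b (ltW r0).
have h2 : r ^+ 2 <= r `^ a.
  by rewrite -powR_mulrn ?(ltW r0)// ger_powR// r0.
have h3 : r <= r `^ (a - 1) by rewrite ger1_powR ?r0//; lra.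
have h4 : a * (r `^ (a - 1) - r) * (- c) <= a * (r `^ (a - 1) - r) * 1.
  by rewrite ler_wpM2l ?mulr_ge0//; lra.
have h5 : a * (r `^ (a - 1) - r) <= 1.
  have : r `^ (a - 1) - r <= 2 - a.
    have : 0 <= (2 - a) * r by rewrite mulr_ge0//; lra.
    lra.
  have : 0 <= (a - 1) ^+ 2 by rewrite sqr_ge0.
  rewrite expr2; nra.
have h6 : a / 2 * r ^+ 2 <= r `^ a.
  have := sqr_ge0 r; nra.
lra.
Qed.

End EuclideanGeometry.

(** * The descent inequality *)

Section Descent.
Context {R : realType} {n : nat}.
Variable f : 'rV[R]_n -> R.
Hypothesis df : forall x, differentiable f x.
Implicit Types (x y v : 'rV[R]_n).

Lemma derive_dot_grad x v : 'D_v f x = dot (grad f x) v.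
Proof.
rewrite deriveE// {1}(row_sum_delta v) linear_sum; apply: eq_bigr => i _.
by rewrite linearZ /= -deriveE// /grad mxE mulrC.
Qed.

Lemma is_derive_along_line x v (t : R) :
  is_derive t 1 (fun s : R => f (x + s *: v)) (dot (grad f (x + t *: v)) v).
Proof.
have quotient : (fun h : R => h^-1 *: (((fun s : R => f (x + s *: v)) \o shift t)
    (h *: 1) - f (x + t *: v))) =
  (fun h => h^-1 *: ((f \o shift (x + t *: v)) (h *: v) - f (x + t *: v))).
  apply/funext => h; congr (_ *: (f _ - _)).
  by rewrite /= /shift/= scalerDl scaler1 addrCA addrA -addrA addrCA.
have dv : derivable f (x + t *: v) v by exact: diff_derivable.
apply: DeriveDef; first by rewrite /derivable quotient.
by rewrite /derive quotient -derive_dot_grad.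
Qed.

(** The mean value theorem for [t |-> f (x + t v) - t c - L / 2 * t ^ 2 * q], whose
    derivative is nonpositive for [t >= 0] because the gradient is Lipschitz. *)
Lemma descent_inequality (L : R) x v : lipschitz_gradient f L ->
  f (x + v) <= f x + dot (grad f x) v + L / 2 * enorm v ^+ 2.
Proof.
move=> lip.
pose q := enorm v ^+ 2; pose c := dot (grad f x) v.
pose g (t : R) := dot (grad f (x + t *: v)) v.
pose psi : R -> R := (fun s => f (x + s *: v)) - (fun s => s * c + L / 2 * q * s ^+ 2).
have dpsi (t : R) : is_derive t (1 : R) psi (g t - (c + L * q * t)).
  apply: is_deriveB; first exact: is_derive_along_line.
  by apply: is_derive_eq; rewrite scaler0 add0r !scaler1 /GRing.scale /=; field.
have cpsi : {within `[0, 1], continuous psi}.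
  apply: derivable_within_continuous => t _; exact: ex_derive.
have [t t01 e] := MVT ltr01 (fun t _ => dpsi t) cpsi.
have [t0 t1] : 0 < t /\ t < 1 by move: t01; rewrite in_itv => /andP[].
have : g t - c <= L * q * t.
  have -> : g t - c = dot (grad f (x + t *: v) - grad f x) v.
    by rewrite dotDl dotNl.
  apply: (le_trans (dot_le _ _)).
  apply: (@le_trans _ _ (L * (t * enorm v) * enorm v)); last first.
    by apply/eq_leW; rewrite /q; ring.
  apply: ler_wpM2r; first exact: enorm_ge0.
  apply: (le_trans (lip _ _)).
  by rewrite addrAC subrr add0r enormZ gtr0_norm.
have -> : f (x + v) = psi 1 + (c + L / 2 * q).
  by rewrite /psi /= !fctE scale1r; ring.
have -> : f x = psi 0.
  by rewrite /psi !fctE scale0r addr0; ring.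
rewrite -/c -/q; move: e; lra.
Qed.

End Descent.

(** * Borel measurability of vector-valued maps *)

Section BorelVectors.
Context {R : realType} {n : nat}.

Lemma continuous_measurable_rV_real (h : 'rV[R]_n -> R) :
  continuous h -> measurable_fun [set: borel_rV R n] h.
Proof.
move=> /continuousP ch _.
apply: (measurability _ (RGenOpens.measurableE R)) => //.
move=> _ [_ [a [b ->]] <-]; rewrite setTI.
by apply: sub_sigma_algebra; apply: ch; exact: interval_open.
Qed.

Lemma continuous_measurable_rV m (h : 'rV[R]_n -> 'rV[R]_m) :
  continuous h -> measurable_fun [set: borel_rV R n] (h : _ -> borel_rV R m).
Proof.
move=> /continuousP ch _; apply: measurability => // _ [U oU <-].
by rewrite setTI; apply: sub_sigma_algebra; exact: ch.
Qed.

Lemma measurable_coord i :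
  measurable_fun [set: borel_rV R n] (fun x : borel_rV R n => (x : 'rV[R]_n) ord0 i).
Proof. by apply: continuous_measurable_rV_real => x; exact: coord_continuous. Qed.

(** An open cube with rational centre and radius. There are countably many, which
    reduces the Borel structure on row vectors to that of the coordinates. *)
Definition rat_box (q : 'rV[rat]_n * rat) : set 'rV[R]_n :=
  [set y | forall i, `|y ord0 i - ratr (q.1 ord0 i)| < ratr q.2].

Lemma open_rat_boxes (U : set 'rV[R]_n) : open U ->
  U = \bigcup_(q in [set q | rat_box q `<=` U]) rat_box q.
Proof.
move=> oU; apply/seteqP; split=> [x Ux|x [q qU qx]]; last exact: qU.
have /nbhs_ballP[e /= e0 eU] : nbhs x U by exact: open_nbhs_nbhs.
have e2 : (0 : R) < e / 2 by rewrite divr_gt0.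
have [r] := rat_in_itvoo e2; rewrite in_itv/= => /andP[r0 re].
have approx i : exists q : rat, `|x ord0 i - ratr q| < ratr r.
  have /rat_in_itvoo[q] : x ord0 i - ratr r < x ord0 i + ratr r by lra.
  by rewrite in_itv/= => /andP[? ?]; exists q; rewrite ltr_norml; lra.
have [q qP] := choice approx.
exists (\row_i q i, r); last by move=> i /=; rewrite mxE.
move=> y hy; apply: eU; split => // j i; rewrite (ord1 j).
have /= := hy i; rewrite mxE => yq.
have := qP i; rewrite /ball /=.
move: yq; rewrite !ltr_norml => /andP[? ?] /andP[? ?]; apply/andP; split; lra.
Qed.

Context d (T : measurableType d).
Implicit Types X Y : T -> borel_rV R n.

(** Preimages of open sets suffice, and an open set is a countable union of cubes,
    each a finite intersection of conditions on single coordinates. *)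
Lemma measurable_rV X :
  (forall i, measurable_fun [set: T] (fun t => (X t : 'rV[R]_n) ord0 i)) ->
  measurable_fun [set: T] X.
Proof.
move=> mX _; apply: measurability => // _ [U oU <-].
rewrite setTI (open_rat_boxes oU) preimage_bigcup bigcup_mkcond.
apply: countable_bigcupT_measurable; first exact: countableP.
move=> q; case: ifP => // _.
have -> : X @^-1` rat_box q = \bigcap_(i in [set: 'I_n])
   (fun t => `|(X t : 'rV[R]_n) ord0 i - ratr (q.1 ord0 i)|) @^-1` `]-oo, ratr q.2[%classic.
  apply/seteqP; split=> [t ht i _|t ht i]; first by rewrite /= in_itv; exact: ht.
  by have := ht i I; rewrite /= in_itv.
apply: fin_bigcap_measurable => // i _.
rewrite -[X in measurable X]setTI; apply: measurableT_comp => //.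
exact: measurable_funB.
Qed.

Lemma measurable_rV_coord X i : measurable_fun [set: T] X ->
  measurable_fun [set: T] (fun t => (X t : 'rV[R]_n) ord0 i).
Proof. by move=> mX; exact: (measurableT_comp (measurable_coord i)). Qed.

Lemma measurable_rVD X Y : measurable_fun [set: T] X -> measurable_fun [set: T] Y ->
  measurable_fun [set: T] (fun t => (X t : 'rV[R]_n) + (Y t : 'rV[R]_n) : borel_rV R n).
Proof.
move=> mX mY; apply: measurable_rV => i; under eq_fun do rewrite mxE.
by apply: measurable_funD; exact: measurable_rV_coord.
Qed.

Lemma measurable_rVZ (c : T -> R) X : measurable_fun [set: T] c ->
  measurable_fun [set: T] X ->
  measurable_fun [set: T] (fun t => c t *: (X t : 'rV[R]_n) : borel_rV R n).
Proof.
move=> mc mX; apply: measurable_rV => i; under eq_fun do rewrite mxE.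
by apply: measurable_funM => //; exact: measurable_rV_coord.
Qed.

Lemma measurable_rVB X Y : measurable_fun [set: T] X -> measurable_fun [set: T] Y ->
  measurable_fun [set: T] (fun t => (X t : 'rV[R]_n) - (Y t : 'rV[R]_n) : borel_rV R n).
Proof.
move=> mX mY; apply: measurable_rV => i; under eq_fun do rewrite !mxE.
by apply: measurable_funB; exact: measurable_rV_coord.
Qed.

Lemma measurable_enorm X : measurable_fun [set: T] X ->
  measurable_fun [set: T] (fun t => enorm (X t : 'rV[R]_n)).
Proof.
move=> mX; apply: (measurableT_comp (continuous_measurable_fun (@sqrt_continuous R))).
apply: measurable_sum => i; apply: measurable_funX; exact: measurable_rV_coord.
Qed.

End BorelVectors.

(** * Independence of the past *)

Section Independence.
Context {R : realType} {d : measure_display} {Omega : measurableType d}.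
Variable P : probability Omega R.

(** On the generated sigma-algebra, [A |-> P (A `&` E)] and [A |-> P E * P A] are
    finite measures that agree on a pi-system. *)
Lemma pi_system_independent (G : set (set Omega)) (E : set Omega) :
  G `<=` measurable -> setI_closed G -> G setT -> measurable E ->
  (forall A, G A -> P (A `&` E) = (P A * P E)%E) ->
  forall A, <<s G >> A -> P (A `&` E) = (P A * P E)%E.
Proof.
move=> Gm GI GT mE hG A sA.
pose r : {nonneg R} := NngNum (fine_ge0 (measure_ge0 P E)).
have rE : (r%:num)%:E = P E by rewrite /= fineK// fin_num_measure.
have eqG B : G B -> mrestr P mE B = mscale r P B.
  by move=> GB; rewrite /mrestr /mscale rE hG// muleC.
have fin (k : nat) : (mrestr P mE setT < +oo)%E.
  by rewrite /mrestr setTI -ge0_fin_numE// fin_num_measure.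
have : P (A `&` E) = ((r%:num)%:E * P A)%E :=
  g_sigma_algebra_measure_unique G Gm (fun=> setT) (fun=> GT)
  (bigcup_const _ (ex_intro _ 0%N Logic.I)) _ _ GI eqG fin _ sA.
by rewrite rE muleC.
Qed.

(** The joint law of independent variables is the product of their laws, so
    Tonelli's theorem integrates the second variable out while the first one is
    frozen. This plays the part of conditional expectation. *)
Lemma integral_independent {d1 d2 : measure_display} {T1 : measurableType d1}
    {T2 : measurableType d2} (Y : {RV P >-> T1}) (Z : {RV P >-> T2})
    (D : probability T2 R) (Phi : T1 * T2 -> \bar R) :
  (forall B, measurable B -> distribution P Z B = D B) ->
  (forall A B, measurable A -> measurable B ->
    P (Y @^-1` A `&` Z @^-1` B) = (P (Y @^-1` A) * P (Z @^-1` B))%E) ->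
  measurable_fun setT Phi -> (forall p, (0 <= Phi p)%E) ->
  (\int[P]_w Phi (Y w, Z w) = \int[P]_w \int[D]_z Phi (Y w, z))%E.
Proof.
move=> ZD indep mPhi Phi0.
have mYZ : measurable_fun setT (fun w => (Y w, Z w)) by exact: measurable_fun_pair.
pose YZ : {mfun Omega >-> (T1 * T2)%type} :=
  HB.pack (fun w => (Y w, Z w)) (isMeasurableFun.Build _ _ _ _ _ mYZ).
have -> : (\int[P]_w Phi (Y w, Z w) = \int[distribution P YZ]_p Phi p)%E.
  by rewrite ge0_integral_distribution.
have -> : (\int[distribution P YZ]_p Phi p =
    \int[distribution P Y \x D]_p Phi p)%E.
  apply: eq_measure_integral => A mA _; apply/esym.
  apply: product_measure_unique => // B C mB mC /=.
  by rewrite -ZD// /distribution /pushforward -indep.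
rewrite fubini_tonelli1//.
rewrite ge0_integral_distribution//; first exact: measurable_fun_fubini_tonelli_F.
by move=> y; exact: integral_ge0.
Qed.

Context {d' : measure_display} {Xi : measurableType d'}.
Variable X : nat -> {RV P >-> Xi}.

Definition past_events (k : nat) : set (set Omega) :=
  \bigcup_(i in `I_k) preimage_set_system setT (X i) measurable.

(** The finite intersections that mutual independence speaks of; they form a
    pi-system generating the past. *)
Definition past_cylinders (k : nat) : set (set Omega) :=
  [set C | exists2 A : nat -> set Xi, (forall i, measurable (A i)) &
    C = \bigcap_(i in [set` iota 0 k]) (X i @^-1` A i)].

Lemma past_cylinders_measurable k : past_cylinders k `<=` measurable.
Proof.
move=> _ [A mA ->]; apply: bigcap_measurableType => i _.
by exact: measurable_funPTI.
Qed.

Lemma past_cylinders_setI k : setI_closed (past_cylinders k).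
Proof.
move=> _ _ [A mA ->] [B mB ->]; exists (fun i => A i `&` B i).
  by move=> i; exact: measurableI.
by rewrite -bigcapI.
Qed.

Lemma past_events_cylinders k : <<s past_events k >> `<=` <<s past_cylinders k >>.
Proof.
apply: smallest_sub; first exact: smallest_sigma_algebra.
move=> _ [i /= ik [B mB <-]]; apply: sub_sigma_algebra.
exists (fun j => if j == i then B else setT); first by move=> j; case: ifP.
rewrite setTI; apply/seteqP; split=> [w Bw j _|w /(_ i)] /=.
  by case: eqP => // ->.
by rewrite eqxx; apply; rewrite /= mem_iota.
Qed.

Lemma past_independent k A B : mutually_independent P X ->
  <<s past_events k >> A -> measurable B ->
  P (A `&` X k @^-1` B) = (P A * P (X k @^-1` B))%E.
Proof.
move=> indep /past_events_cylinders sA mB.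
apply: pi_system_independent sA => //.
- exact: past_cylinders_measurable.
- exact: past_cylinders_setI.
- exists (fun=> setT) => //; apply/seteqP; split=> //.
- by exact: measurable_funPTI.
move=> _ [C mC ->].
pose C' i := if i == k then B else C i.
have mC' i : measurable (C' i) by rewrite /C'; case: ifP.
have := indep (rcons (iota 0 k) k) C' _ mC'.
have kn : k \notin iota 0 k by rewrite mem_iota add0n ltnn andbF.
have C'C i : i \in iota 0 k -> C' i = C i.
  by move=> ik; rewrite /C'; case: eqP => // ek; move: kn; rewrite -{1}ek ik.
rewrite rcons_uniq kn iota_uniq => /(_ isT).
have C'k : C' k = B by rewrite /C' eqxx.
rewrite big_rcons /= C'k.
have -> : \bigcap_(i in [set` rcons (iota 0 k) k]) X i @^-1` C' i =
    (\bigcap_(i in [set` iota 0 k]) X i @^-1` C i) `&` X k @^-1` B.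
  apply/seteqP; split=> [w hw|w [hw Bw] i /=].
    split=> [i ik|].
      by rewrite -C'C//; apply: hw; rewrite /= mem_rcons inE ik orbT.
    by have := hw k; rewrite /= /C' eqxx; apply; rewrite mem_rcons mem_head.
  rewrite mem_rcons inE => /predU1P[->|ik]; first by rewrite /C' eqxx.
  by rewrite C'C//; exact: hw.
move=> ->; rewrite (indep _ _ (iota_uniq 0 k) mC); congr (_ * _)%E.
by rewrite [LHS]big_seq [RHS]big_seq; apply: eq_bigr => i /C'C ->.
Qed.

End Independence.

(** * The iterates depend on the past only *)

Section PastMeasurability.
Context {R : realType} {d d' : measure_display} {Omega : measurableType d}
  {Xi : measurableType d'} {P : probability Omega R}.
Variable xi : nat -> {RV P >-> Xi}.

(** The sample space with the sigma-algebra of the first [k] samples only: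
    measurability of a map on this space says that it depends on the past. *)
Definition past_space (k : nat) := g_sigma_algebraType (past_events xi k).

Lemma past_events_measurable k : past_events xi k `<=` measurable.
Proof.
by move=> _ [i _ [B mB <-]]; rewrite setTI; exact: measurable_funPTI.
Qed.

Lemma sub_past_measurable k (B : set Omega) : <<s past_events xi k >> B ->
  measurable B.
Proof.
apply: smallest_sub; last exact: past_events_measurable.
exact: sigma_algebra_measurable.
Qed.

Lemma past_sigma_generated k (B : set Omega) : <<s past_events xi k >> B ->
  sigma_generated xi B.
Proof.
apply: sub_smallest2r; first exact: smallest_sigma_algebra.
by move=> A [i _ hA]; exists i.
Qed.

Context {d'' : measure_display} {T : measurableType d''}.

Lemma measurable_past_succ k (X : Omega -> T) :
  measurable_fun [set: past_space k] X -> measurable_fun [set: past_space k.+1] X.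
Proof.
move=> mX _ B mB; have := mX measurableT B mB.
rewrite !setTI; apply: sub_smallest2r; first exact: smallest_sigma_algebra.
by move=> A [i /= ik hA]; exists i => //=; exact: ltnW.
Qed.

Lemma measurable_of_past k (X : Omega -> T) :
  measurable_fun [set: past_space k] X -> measurable_fun [set: Omega] X.
Proof.
move=> mX _ B mB; have := mX measurableT B mB.
by rewrite !setTI; exact: sub_past_measurable.
Qed.

End PastMeasurability.

Section IteratesMeasurability.
Context {R : realType} {n : nat} {d d' : measure_display} {Omega : measurableType d}
  {Xi : measurableType d'} {P : probability Omega R}.
Variables (G : 'rV[R]_n -> Xi -> 'rV[R]_n) (xi : nat -> {RV P >-> Xi}).
Hypothesis hG : jointly_measurable G.

Lemma measurable_estimator {d1 : measure_display} {T : measurableType d1}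
    (X : T -> borel_rV R n) (Z : T -> Xi) :
  measurable_fun [set: T] X -> measurable_fun [set: T] Z ->
  measurable_fun [set: T] (fun w => G (X w) (Z w) : borel_rV R n).
Proof.
by move=> mX mZ; exact: (measurableT_comp hG (measurable_fun_pair mX mZ)).
Qed.

Lemma measurable_sample_past k : measurable_fun [set: past_space xi k.+1] (xi k).
Proof.
move=> _ B mB; apply: sub_sigma_algebra; exists k => /=; first exact: ltnSn.
by exists B.
Qed.

(** The point [x k] is determined by the first [k] samples and the momentum [m k]
    by the first [k + 1], so that sample [k + 1] is independent of the triple
    [x k], [x k.+1], [m k]. *)
Lemma iterates_measurable_past (x0 : 'rV[R]_n) (eta theta : nat -> R)
    (x m : nat -> Omega -> 'rV[R]_n) k :
  nsfom_rm G x0 eta theta xi x m ->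
  measurable_fun [set: past_space xi k] (x k : _ -> borel_rV R n) /\
  measurable_fun [set: past_space xi k.+1] (m k : _ -> borel_rV R n).
Proof.
move=> hx.
have mom j : measurable_fun [set: past_space xi j] (x j : _ -> borel_rV R n) ->
    measurable_fun [set: past_space xi j]
      (fun w => past x0 (x ^~ w) j : borel_rV R n) ->
    measurable_fun [set: past_space xi j]
      (fun w => past 0 (m ^~ w) j : borel_rV R n) ->
    measurable_fun [set: past_space xi j.+1] (m j : _ -> borel_rV R n).
  move=> mx mpx mpm.
  have -> : m j = fun w =>
        (1 - past 1 theta j) *: past 0 (m ^~ w) j + G (x j w) (xi j w)
        - (1 - past 1 theta j) *: G (past x0 (x ^~ w) j) (xi j w).
    by apply/funext => w; have [_ -> _] := hx w.
  have mxi : measurable_fun [set: past_space xi j.+1] (xi j).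
    exact: measurable_sample_past.
  apply: measurable_rVB; last first.
    apply: measurable_rVZ => //; apply: measurable_estimator => //.
    exact: measurable_past_succ.
  apply: measurable_rVD.
    by apply: measurable_rVZ => //; exact: measurable_past_succ.
  by apply: measurable_estimator => //; exact: measurable_past_succ.
elim: k => [|k [mx mm]].
  have mx : measurable_fun [set: past_space xi 0] (x 0%N : _ -> borel_rV R n).
    have -> : x 0%N = cst x0 by apply/funext => w; have [-> _ _] := hx w.
    exact: measurable_cst.
  by split=> //; apply: mom => //=; exact: measurable_cst.
have mx' : measurable_fun [set: past_space xi k.+1] (x k.+1 : _ -> borel_rV R n).
  have -> : x k.+1 = fun w => x k w - (eta k * enorm (m k w) `^ (-1)) *: m k w.
    (* measurability of the inverse is obtained through the power [-1] *)
    by apply/funext => w; rewrite powR_inv1 ?enorm_ge0//; have [_ _ ->] := hx w.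
  apply: measurable_rVB; first exact: measurable_past_succ.
  apply: measurable_rVZ => //; apply: measurable_funM => //.
  apply: (measurableT_comp (measurable_powR _)); exact: measurable_enorm.
split=> //; apply: mom => //=; exact: measurable_past_succ.
Qed.

End IteratesMeasurability.

(** * One step of the momentum recursion for a fixed past *)

Section RealExpectation.
Context {R : realType} {d : measure_display} {T : measurableType d}.
Variable P : probability T R.
Implicit Types (X Y : T -> R) (c r : R).

(** Integrability is carried along with the value, because the linearity of the
    expectation requires it. *)
Definition has_expectation X c := X \in Lfun P 1 /\ 'E_P[X]%E = c%:E.

Lemma has_expectation_cst r : has_expectation (fun=> r) r.
Proof. by split; [exact: Lfun_cst|exact: expectation_cst]. Qed.

Lemma has_expectationD X Y c r : has_expectation X c -> has_expectation Y r ->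
  has_expectation (fun z => X z + Y z) (c + r).
Proof.
move=> [iX eX] [iY eY]; split; first exact: rpredD.
by have := expectationD iX iY; rewrite eX eY.
Qed.

Lemma has_expectationZ X c r : has_expectation X c ->
  has_expectation (fun z => r * X z) (r * c).
Proof.
move=> [iX eX]; split; first exact: (rpredZ r iX).
have := expectationZl r iX; rewrite eX -EFinM => <-.
by congr expectation; apply/funext => z; rewrite /= mulrC.
Qed.

Lemma has_expectationB X Y c r : has_expectation X c -> has_expectation Y r ->
  has_expectation (fun z => X z - Y z) (c - r).
Proof.
move=> hX /(has_expectationZ (-1)); rewrite mulN1r.
by under eq_fun do rewrite mulN1r; exact: has_expectationD.
Qed.

Lemma has_expectation_sum m (X : 'I_m -> T -> R) (c : 'I_m -> R) :
  (forall i, has_expectation (X i) (c i)) ->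
  has_expectation (fun z => \sum_(i < m) X i z) (\sum_(i < m) c i).
Proof.
elim: m X c => [|m IH] X c h.
  by under eq_fun do rewrite big_ord0; rewrite big_ord0; exact: has_expectation_cst.
under eq_fun do rewrite big_ord_recl; rewrite big_ord_recl.
by apply: has_expectationD => //; apply: IH.
Qed.

Lemma ge0_has_expectation X c : measurable_fun [set: T] X -> (forall z, 0 <= X z) ->
  ('E_P[X] <= c%:E)%E -> exists2 r, has_expectation X r & r <= c.
Proof.
move=> mX X0 hc.
have E0 : (0 <= 'E_P[X])%E by exact: expectation_ge0.
have fE : ('E_P[X] \is a fin_num)%E.
  by rewrite ge0_fin_numE//; exact: le_lt_trans hc (ltry _).
exists (fine 'E_P[X]%E); last by rewrite -lee_fin fineK.
split; last by rewrite fineK.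
apply/Lfun1_integrable/integrableP; split; first exact/measurable_EFinP.
under eq_integral do rewrite /= ger0_norm//.
by move: fE; rewrite ge0_fin_numE// unlock.
Qed.

Lemma le_has_expectation X Y c : measurable_fun [set: T] X ->
  (forall z, 0 <= X z <= Y z) -> has_expectation Y c -> ('E_P[X] <= c%:E)%E.
Proof.
move=> mX XY [iY <-]; apply: expectation_le => //.
- by have /Lfun1_integrable/integrableP[/measurable_EFinP] := iY.
- by move=> z; have /andP[] := XY z.
- by move=> z; have /andP[] := XY z; exact: le_trans.
- by apply: aeW => z; have /andP[] := XY z.
Qed.

(** Domination by [1 + X] suffices, since the first moment is finite on a
    probability space as soon as a higher one is. *)
Lemma dominated_Lfun1 X Y : measurable_fun [set: T] Y -> X \in Lfun P 1 ->
  (forall z, `|Y z| <= 1 + X z) -> Y \in Lfun P 1.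
Proof.
move=> mY iX h; apply/Lfun1_integrable.
have i1 : (fun z => 1 + X z) \in Lfun P 1 by apply: (rpredD (Lfun_cst _ _ 1) iX).
have /Lfun1_integrable := i1; apply: le_integrable => //.
  exact/measurable_EFinP.
by move=> z _; rewrite /= lee_fin (le_trans (h z))// ler_norm.
Qed.

End RealExpectation.

Section OneStepMoment.
Context {R : realType} {n : nat} {d : measure_display} {Xi : measurableType d}.
Variables (D : probability Xi R) (f : 'rV[R]_n -> R) (G : 'rV[R]_n -> Xi -> 'rV[R]_n).
Variables (alpha sigma L1 L : R).
Hypotheses (halpha : 1 < alpha <= 2) (hG : jointly_measurable G).
Hypotheses (hmean : unbiased D f G) (hvar : central_moment_bound D f G alpha sigma).
Hypotheses (hsmooth : weakly_average_smooth D G alpha L).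
Hypotheses (hL1 : 0 <= L1) (hlip : lipschitz_gradient f L1).
Implicit Types x y a : 'rV[R]_n.

Let measurable_G x : measurable_fun [set: Xi] (G x : Xi -> borel_rV R n).
Proof. exact: (measurable_fun_pair2 (x : borel_rV R n) hG). Qed.

Lemma measurable_powR_enorm {d1 : measure_display} {T : measurableType d1} (c : R)
    (X : T -> borel_rV R n) : measurable_fun [set: T] X ->
  measurable_fun [set: T] (fun t => enorm (X t : 'rV[R]_n) `^ c).
Proof.
by move=> mX; apply: (measurableT_comp (measurable_powR c)); exact: measurable_enorm.
Qed.

Lemma central_moment_expectation x :
  exists2 v, has_expectation D (fun z => enorm (G x z - grad f x) `^ alpha) v &
    v <= sigma `^ alpha.
Proof.
apply: ge0_has_expectation => //; last by move=> z; exact: powR_ge0.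
by apply: measurable_powR_enorm; apply: measurable_rVB => //; exact: measurable_cst.
Qed.

Lemma smoothness_expectation x y :
  exists2 u, has_expectation D (fun z => enorm (G x z - G y z) `^ alpha) u &
    u <= L `^ alpha * enorm (x - y) `^ alpha.
Proof.
apply: ge0_has_expectation => //; last by move=> z; exact: powR_ge0.
by apply: measurable_powR_enorm; exact: measurable_rVB.
Qed.

(** Integrability of the coordinates comes from the central moment of order
    [alpha > 1]. *)
Lemma estimator_coord_expectation x i :
  has_expectation D (fun z => G x z ord0 i) (grad f x ord0 i).
Proof.
split; last exact: hmean.
have [v [iv _] _] := central_moment_expectation x.
have i1 : (fun z => enorm (G x z - grad f x) `^ alpha + `|grad f x ord0 i|)
    \in Lfun D 1.
  by apply: (rpredD iv); exact: Lfun_cst.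
apply: dominated_Lfun1 i1 _; first exact: measurable_rV_coord.
move=> z; rewrite addrA.
have -> : G x z ord0 i = (G x z - grad f x) ord0 i + grad f x ord0 i.
  by rewrite !mxE subrK.
apply: (le_trans (ler_normD _ _)); rewrite lerD2r.
apply: (le_trans (coord_le_enorm _ _)).
have [t1|t1] := leP (enorm (G x z - grad f x)) 1.
  by have := powR_ge0 (enorm (G x z - grad f x)) alpha; lra.
have [a1 a2] := andP halpha.
have := le1r_powR (ltW t1) (ltW a1); lra.
Qed.

(** The core of the variance reduction, for fixed points [x], [y] and error vector [a].
    The increment [Z] has mean zero, so the linear term of [enormD_powR]
    vanishes in expectation. [Z] splits into the difference of two estimators
    driven by the same sample, the difference of the gradients, both of order
    [e], and [th] times the noise of a single estimator. *)
Lemma momentum_moment_le a x y th e : 0 <= th <= 1 -> enorm (y - x) <= e ->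
  ('E_D[fun z => (enorm ((1 - th) *: a +
      (G y z - grad f y - (1 - th) *: (G x z - grad f x))) `^ alpha)%R]
   <= ((1 - th) * enorm a `^ alpha + (6 * (L1 `^ alpha + L `^ alpha) * e `^ alpha
       + 6 * sigma `^ alpha * th `^ alpha))%R%:E)%E.
Proof.
move=> /andP[th0 th1] hxy.
have [a1 a2] := andP halpha.
have e0 : 0 <= e by apply: le_trans hxy; exact: enorm_ge0.
pose b := (1 - th) *: a.
pose Z z := (G y z - G x z) - (grad f y - grad f x) + th *: (G x z - grad f x).
have splitZ z : (1 - th) *: a + (G y z - grad f y - (1 - th) *: (G x z - grad f x))
    = b + Z z by apply/rowP => i; rewrite !mxE; ring.
have [u hu ule] := smoothness_expectation y x.
have [v hv vle] := central_moment_expectation x.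
have hZ : has_expectation D (fun z => dot b (Z z)) 0.
  have -> : 0 = \sum_(i < n) b ord0 i * ((grad f y ord0 i - grad f x ord0 i) -
      (grad f y ord0 i - grad f x ord0 i) + th * (grad f x ord0 i - grad f x ord0 i)).
    by rewrite big1// => i _; ring.
  apply: has_expectation_sum => i; apply: has_expectationZ.
  have coordE (p q r s t w : 'rV[R]_n) : (p - q - (r - s) + th *: (t - w)) ord0 i
      = p ord0 i - q ord0 i - (r ord0 i - s ord0 i) + th * (t ord0 i - w ord0 i).
    by rewrite !mxE.
  under eq_fun do rewrite coordE.
  have hc c := @has_expectation_cst R d Xi D c.
  apply: has_expectationD; last first.
    apply: has_expectationZ; apply: has_expectationB; last exact: hc.
    exact: estimator_coord_expectation.
  apply: has_expectationB.
    by apply: has_expectationB; exact: estimator_coord_expectation.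
  by apply: has_expectationB; exact: hc.
have Zle z : enorm (Z z) `^ alpha <= 3 * (enorm (G y z - G x z) `^ alpha
    + (L1 * e) `^ alpha + th `^ alpha * enorm (G x z - grad f x) `^ alpha).
  have l1e : 0 <= L1 * e by rewrite mulr_ge0.
  have tn : 0 <= th * enorm (G x z - grad f x) by rewrite mulr_ge0 ?enorm_ge0.
  rewrite -powRM ?enorm_ge0//.
  apply: le_trans (powR_add3_le _ _ _ _); rewrite ?enorm_ge0//; last by lra.
  rewrite ge0_ler_powR ?nnegrE ?addr_ge0 ?enorm_ge0//; first lra.
  apply: (le_trans (ler_enormD _ _)); rewrite enormZ (ger0_norm th0) lerD2r.
  apply: (le_trans (ler_enormD _ _)); rewrite enormN lerD2l.
  by apply: (le_trans (hlip _ _)); rewrite ler_wpM2l.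
pose val := enorm b `^ alpha + alpha * enorm b `^ (alpha - 2) * 0 +
  6 * (u + (L1 * e) `^ alpha + th `^ alpha * v).
have bval : enorm b `^ alpha <= (1 - th) * enorm a `^ alpha.
  have s0 : 0 <= 1 - th by rewrite subr_ge0.
  rewrite /b enormZ (ger0_norm s0) (powRM _ s0 (enorm_ge0 _)).
  rewrite ler_wpM2r ?powR_ge0//.
  have [t0|t0] := leP (1 - th) 0.
    have -> : 1 - th = 0 by lra.
    by rewrite powR0//; apply: lt0r_neq0; lra.
  by rewrite ge1r_powR//; lra.
apply: (@le_trans _ _ val%:E).
  apply: (le_has_expectation (Y := fun z => enorm b `^ alpha +
    alpha * enorm b `^ (alpha - 2) * dot b (Z z) + 6 * (enorm (G y z - G x z) `^ alpha
    + (L1 * e) `^ alpha + th `^ alpha * enorm (G x z - grad f x) `^ alpha))).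
  - have mc (c : 'rV[R]_n) : measurable_fun [set: Xi] (cst c : Xi -> borel_rV R n).
      exact: measurable_cst.
    apply: measurable_powR_enorm; apply: measurable_rVD; first exact: mc.
    apply: measurable_rVB; first by apply: measurable_rVB => //; exact: mc.
    by apply: measurable_rVZ => //; apply: measurable_rVB => //; exact: mc.
  - move=> z; rewrite powR_ge0 splitZ /=; apply: (le_trans (enormD_powR _ _ halpha)).
    rewrite lerD2l; have := ler_wpM2l (ler0n R 2) (Zle z).
    by rewrite [X in _ <= X -> _]mulrA -natrM.
  - have hc c := @has_expectation_cst R d Xi D c.
    do ![apply: has_expectationD => //|apply: has_expectationZ => //|exact: hc].
rewrite lee_fin /val mulr0 addr0.
have -> : (L1 * e) `^ alpha = L1 `^ alpha * e `^ alpha by rewrite powRM.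
have h1 : u <= L `^ alpha * e `^ alpha.
  apply: (le_trans ule); rewrite ler_wpM2l ?powR_ge0//.
  by rewrite ge0_ler_powR ?nnegrE ?enorm_ge0//; lra.
have h2 := ler_wpM2l (powR_ge0 th alpha) vle.
lra.
Qed.

End OneStepMoment.

(** * The expected recursions *)

Section NormalizedStep.
Context {R : realType} {n : nat}.
Variables (f : 'rV[R]_n -> R) (L1 : R).
Hypotheses (df : forall x, differentiable f x) (L10 : 0 <= L1).
Hypothesis hlip : lipschitz_gradient f L1.
Implicit Types (x m : 'rV[R]_n) (h : R).

Lemma normalized_step_length m h : 0 <= h -> enorm ((h / enorm m) *: m) <= h.
Proof.
move=> h0; rewrite enormZ ger0_norm ?divr_ge0 ?enorm_ge0//.
have [->|mn0] := eqVneq (enorm m) 0; first by rewrite mulr0.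
by rewrite divfK.
Qed.

(** Normalization makes the decrease linear in the gradient norm: the step has
    inner product [h * enorm m] with the momentum, and replacing the momentum by
    the gradient costs at most [2 * h * enorm (m - grad f x)]. If [m = 0] the
    iterate does not move, and [enorm (m - grad f x)] is the gradient norm. *)
Lemma normalized_step_descent x m h : 0 <= h ->
  f (x - (h / enorm m) *: m) + h * enorm (grad f x) <=
  f x + 2 * h * enorm (m - grad f x) + L1 / 2 * h ^+ 2.
Proof.
move=> h0; set g := grad f x.
have tri : enorm g <= enorm m + enorm (m - g).
  by have := ler_enormD m (- (m - g)); rewrite enormN opprB addrC subrK.
have q0 : 0 <= L1 / 2 * h ^+ 2 by rewrite mulr_ge0 ?divr_ge0 ?sqr_ge0.
have hn : 0 <= h * enorm (m - g) by rewrite mulr_ge0 ?enorm_ge0.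
have [m0|mn0] := eqVneq (enorm m) 0.
  rewrite m0 invr0 mulr0 scale0r subr0.
  have := ler_wpM2l h0 tri; rewrite m0 add0r; lra.
have m0 : 0 < enorm m by rewrite lt_def mn0 enorm_ge0.
have := descent_inequality df x (- ((h / enorm m) *: m)) hlip.
rewrite -/g enormN dotNr dotZr.
have le_h : L1 / 2 * enorm ((h / enorm m) *: m) ^+ 2 <= L1 / 2 * h ^+ 2.
  rewrite ler_wpM2l ?divr_ge0// ler_pXn2r ?nnegrE ?enorm_ge0//.
  exact: normalized_step_length.
have inner : h * (enorm m - enorm (m - g)) <= h / enorm m * dot g m.
  have -> : dot g m = enorm m ^+ 2 - dot (m - g) m.
    by rewrite enorm_sqr dotDl dotNl opprB addrC subrK.
  have -> : h * (enorm m - enorm (m - g)) =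
      h / enorm m * (enorm m ^+ 2 - enorm (m - g) * enorm m) by field.
  by rewrite ler_wpM2l ?divr_ge0 ?enorm_ge0// lerD2l lerN2 dot_le.
have := ler_wpM2l h0 tri.
move: inner le_h hn; move: (f (x - _)) (f x) (dot g m) (enorm g) (enorm (m - g)).
move: (enorm (_ *: _) ^+ 2) => v F1 F2 dt eg em.
lra.
Qed.

End NormalizedStep.

Section ExpectedRecursions.
Context {R : realType} {n : nat} {d d' : measure_display} {Xi : measurableType d}
  {Omega : measurableType d'}.
Variables (D : probability Xi R) (P : probability Omega R).
Variables (f : 'rV[R]_n -> R) (G : 'rV[R]_n -> Xi -> 'rV[R]_n).
Variables (flow L1 sigma alpha L : R).
Hypothesis hf : continuously_differentiable f.
Hypothesis hG : jointly_measurable G.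
Hypotheses (L10 : 0 <= L1) (halpha : 1 < alpha <= 2).
Hypothesis hlow : bounded_below_by f flow.
Hypothesis hlip : lipschitz_gradient f L1.
Hypothesis hmean : unbiased D f G.
Hypothesis hvar : central_moment_bound D f G alpha sigma.
Hypothesis hsmooth : weakly_average_smooth D G alpha L.
Variables (x0 : 'rV[R]_n) (eta : nat -> R).
Hypothesis eta01 : forall k, 0 <= eta k <= 1.
Variables (xi : nat -> {RV P >-> Xi}).
Hypothesis hxi : iid_samples D xi.
Variables (x m : nat -> Omega -> 'rV[R]_n).
Hypothesis hx : nsfom_rm G x0 eta eta xi x m.

Definition momentum_error k w : R := enorm (m k w - grad f (x k w)) `^ alpha.

Definition gradient_norm k w : R := enorm (grad f (x k w)).

Lemma measurable_grad : measurable_fun [set: borel_rV R n] (grad f : _ -> borel_rV R n).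
Proof. by apply: continuous_measurable_rV; case: hf. Qed.

Lemma measurable_f : measurable_fun [set: borel_rV R n] f.
Proof.
apply: continuous_measurable_rV_real => y.
by apply: differentiable_continuous; case: hf.
Qed.

Lemma iterate_measurable k : measurable_fun [set: Omega] (x k : _ -> borel_rV R n).
Proof. by have [/measurable_of_past] := iterates_measurable_past hG k hx. Qed.

Lemma momentum_measurable k : measurable_fun [set: Omega] (m k : _ -> borel_rV R n).
Proof. by have [_ /measurable_of_past] := iterates_measurable_past hG k hx. Qed.

Lemma gradient_norm_measurable k : measurable_fun [set: Omega] (gradient_norm k).
Proof.
apply: measurable_enorm.
exact: (measurableT_comp measurable_grad (iterate_measurable k)).
Qed.

Lemma momentum_error_measurable k : measurable_fun [set: Omega] (momentum_error k).
Proof.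
apply: measurable_powR_enorm; apply: measurable_rVB; first exact: momentum_measurable.
exact: (measurableT_comp measurable_grad (iterate_measurable k)).
Qed.

Lemma gap_measurable k : measurable_fun [set: Omega] (fun w => f (x k w) - flow).
Proof.
apply: measurable_funB; last exact: measurable_cst.
exact: (measurableT_comp measurable_f (iterate_measurable k)).
Qed.

Lemma momentum_error0_le : ('E_P[momentum_error 0%N] <= (sigma `^ alpha)%:E)%E.
Proof.
apply: le_trans (hvar x0); rewrite unlock; apply: eq_leW.
pose Phi z := (enorm (G x0 z - grad f x0) `^ alpha)%:E.
have Phi0 z : (0 <= Phi z)%E by rewrite lee_fin powR_ge0.
have mPhi : measurable_fun [set: Xi] Phi.
  apply/measurable_EFinP; apply: measurable_powR_enorm; apply: measurable_rVB.
    exact: (measurable_fun_pair2 (x0 : borel_rV R n) hG).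
  exact: measurable_cst.
have -> : (\int[D]_z Phi z = \int[distribution P (xi 0%N)]_z Phi z)%E.
  by apply: eq_measure_integral => A mA _; have [e _] := hxi; exact/esym/e.
rewrite (ge0_integral_distribution (xi 0%N) mPhi Phi0).
apply: eq_integral => w _; have [xE mE _] := hx w.
by rewrite /momentum_error mE /= xE subrr !scale0r add0r subr0.
Qed.

(** Given the past, [momentum_moment_le] bounds the expectation over the fresh
    sample; [integral_independent] carries this to the whole space. *)
Lemma momentum_errorS_le k c : has_expectation P (momentum_error k) c ->
  ('E_P[momentum_error k.+1] <= ((1 - eta k) * c +
     (6 * (L1 `^ alpha + L `^ alpha) * eta k `^ alpha
      + 6 * sigma `^ alpha * eta k `^ alpha))%R%:E)%E.
Proof.
move=> hk; set C := (X in (1 - eta k) * c + X).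
have /andP[eta0 eta1] := eta01 k.
have [/measurable_past_succ mxk mmk] := iterates_measurable_past hG k hx.
have [mxk1 _] := iterates_measurable_past hG k.+1 hx.
pose V := borel_rV R n.
pose y w : V * V * V := (x k w, x k.+1 w, m k w).
have my : measurable_fun [set: past_space xi k.+1] y.
  by apply: measurable_fun_pair => //; exact: measurable_fun_pair.
pose Y : {mfun Omega >-> (V * V * V)%type} :=
  HB.pack y (isMeasurableFun.Build _ _ _ _ _ (measurable_of_past my)).
pose Phi (p : V * V * V * Xi) : R := enorm
  ((1 - eta k) *: ((p.1.2 : 'rV[R]_n) - grad f p.1.1.1) +
   (G p.1.1.2 p.2 - grad f p.1.1.2 - (1 - eta k) *: (G p.1.1.1 p.2 - grad f p.1.1.1)))
   `^ alpha.
have mPhi : measurable_fun setT Phi.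
  have m1 : measurable_fun setT (fun p : V * V * V * Xi => p.1.1.1).
    by do 2!apply: measurableT_comp => //.
  have m2 : measurable_fun setT (fun p : V * V * V * Xi => p.1.1.2).
    by do 2!apply: measurableT_comp => //.
  have m3 : measurable_fun setT (fun p : V * V * V * Xi => p.1.2).
    by apply: measurableT_comp => //.
  have mz : measurable_fun setT (fun p : V * V * V * Xi => p.2).
    exact: measurable_snd.
  have g1 := measurableT_comp measurable_grad m1.
  have g2 := measurableT_comp measurable_grad m2.
  apply: measurable_powR_enorm; apply: measurable_rVD.
    by apply: measurable_rVZ => //; exact: measurable_rVB.
  apply: measurable_rVB.
    by apply: measurable_rVB => //; exact: (measurable_estimator hG).
  apply: measurable_rVZ => //; apply: measurable_rVB => //.
  exact: (measurable_estimator hG).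
(* the part of the new error carried over from the old one is isolated *)
have recursion (t : R) (a b q g h : 'rV[R]_n) : (1 - t) *: a + b - (1 - t) *: q - h
    = (1 - t) *: (a - g) + (b - h - (1 - t) *: (q - g)).
  by apply/rowP => i; rewrite !mxE; ring.
have errorE w : momentum_error k.+1 w = Phi (Y w, xi k.+1 w).
  have [_ mE _] := hx w.
  by rewrite /momentum_error mE (recursion _ _ _ _ (grad f (x k w))).
have Phi0 p : (0 <= (Phi p)%:E)%E by rewrite lee_fin powR_ge0.
have xiD B : measurable B -> distribution P (xi k.+1) B = D B.
  by have [e _] := hxi; exact: e.
have indep A B : measurable A -> measurable B ->
    P (Y @^-1` A `&` xi k.+1 @^-1` B) = (P (Y @^-1` A) * P (xi k.+1 @^-1` B))%E.
  move=> mA mB; apply: past_independent => //; first by case: hxi.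
  by have := my measurableT A mA; rewrite setTI.
have mEPhi : measurable_fun setT (EFin \o Phi) by exact/measurable_EFinP.
have := integral_independent xiD indep mEPhi Phi0.
have -> : (\int[P]_w (EFin \o Phi) (Y w, xi k.+1 w) = 'E_P[momentum_error k.+1])%E.
  by rewrite unlock; apply: eq_integral => w _; rewrite errorE.
move=> ->.
have step w : (\int[D]_z (Phi (Y w, z))%:E <=
    ((1 - eta k) * momentum_error k w + C)%:E)%E.
  have := @momentum_moment_le _ n _ Xi D f G alpha sigma L1 L halpha hG hmean
    hvar hsmooth L10 hlip (m k w - grad f (x k w)) (x k w) (x k.+1 w) (eta k) (eta k).
  rewrite unlock; apply; first by rewrite eta0.
  have [_ _ ->] := hx w; rewrite addrAC subrr add0r enormN.
  exact: normalized_step_length.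
have [iE eE] := has_expectationD (has_expectationZ (1 - eta k) hk)
  (has_expectation_cst P C).
rewrite -eE unlock; apply: ge0_le_integral => //.
- by move=> w _; apply: integral_ge0 => z _; exact: Phi0.
- have mF := measurable_fun_fubini_tonelli_F (m2 := D) _ mEPhi Phi0.
  exact: (measurableT_comp mF (measurable_funPT Y)).
- by move/Lfun1_integrable/integrableP : iE => [].
- by move=> w _; exact: step.
Qed.

(** Adding [normalized_step_descent] and [young_step] pointwise, where the
    quadratic term is also of order [N^-1]. *)
Lemma gap_step_le k N a b :
  1 <= N -> eta k = N `^ (- step_exp alpha) ->
  has_expectation P (fun w => f (x k w) - flow) a ->
  has_expectation P (momentum_error k) b ->
  ('E_P[fun w => (f (x k.+1 w) - flow + eta k * gradient_norm k w)%R] <=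
   (a + (N `^ weight_exp alpha * eta k / 2 * b +
         (young_const alpha + L1 / 2) * N^-1))%R%:E)%E.
Proof.
move=> N1 etaE ha hb; have N0 : 0 < N by exact: lt_le_trans N1.
have [a1 a2] := andP halpha.
have /andP[eta0 eta1] := eta01 k.
apply: (le_has_expectation (Y := fun w => f (x k w) - flow +
    (N `^ weight_exp alpha * eta k / 2 * momentum_error k w +
     (young_const alpha + L1 / 2) * N^-1))); last first.
- apply: (has_expectationD ha).
  apply: has_expectationD; last exact: has_expectation_cst.
  exact: has_expectationZ.
- move=> w /=; rewrite addr_ge0 ?subr_ge0 ?hlow ?mulr_ge0 ?enorm_ge0//=.
  have [_ _ ->] := hx w.
  have h1 := normalized_step_descent hf.1 L10 hlip (x k w) (m k w) eta0.
  have h2 := young_step a1 a2 N0 (enorm_ge0 (m k w - grad f (x k w))).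
  have h3 := ler_wpM2l (divr_ge0 L10 (ler0n R 2)) (step_sqr_le a1 a2 N1).
  rewrite -etaE in h2 h3.
  have combine (F0 F1 h e q u v W g : R) : F1 + h * g <= F0 + 2 * h * e + q * h ^+ 2 ->
      2 * h * e <= W + u * v -> q * h ^+ 2 <= q * v ->
      F1 - flow + h * g <= F0 - flow + (W + (u + q) * v) by lra.
  exact: combine h1 h2 h3.
- apply: measurable_funD; first exact: gap_measurable.
  by apply: measurable_funM => //; exact: gradient_norm_measurable.
Qed.

End ExpectedRecursions.

(** * The weighted sum of gradient norms *)

Section WeightedGradientSum.
Context {R : realType} {n : nat} {d d' : measure_display} {Xi : measurableType d}
  {Omega : measurableType d'}.
Variables (D : probability Xi R) (P : probability Omega R).
Variables (f : 'rV[R]_n -> R) (G : 'rV[R]_n -> Xi -> 'rV[R]_n).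
Variables (flow L1 sigma alpha L : R).
Hypothesis hf : continuously_differentiable f.
Hypothesis hG : jointly_measurable G.
Hypotheses (L10 : 0 <= L1) (halpha : 1 < alpha <= 2).
Hypothesis hlow : bounded_below_by f flow.
Hypothesis hlip : lipschitz_gradient f L1.
Hypothesis hmean : unbiased D f G.
Hypothesis hvar : central_moment_bound D f G alpha sigma.
Hypothesis hsmooth : weakly_average_smooth D G alpha L.
Variables (x0 : 'rV[R]_n) (eta : nat -> R).
Hypothesis etaE : forall k, eta k = k.+1%:R `^ (- step_exp alpha).
Variables (xi : nat -> {RV P >-> Xi}).
Hypothesis hxi : iid_samples D xi.
Variables (x m : nat -> Omega -> 'rV[R]_n).
Hypothesis hx : nsfom_rm G x0 eta eta xi x m.

Let a1 : 1 < alpha. Proof. by case/andP: halpha. Qed.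
Let a2 : alpha <= 2. Proof. by case/andP: halpha. Qed.

Let eta_gt0 k : 0 < eta k. Proof. by rewrite etaE powR_gt0. Qed.

Let eta01 k : 0 <= eta k <= 1.
Proof.
have h : (k.+1%:R : R) `^ (- step_exp alpha) <= k.+1%:R `^ 0.
  by apply: ler_powR; [rewrite ler1n|have /andP[] := step_exp_bounds a1 a2; lra].
by rewrite (ltW (eta_gt0 k)) etaE; rewrite powRr0 in h.
Qed.

Let noise := 6 * (L1 `^ alpha + L `^ alpha) + 6 * sigma `^ alpha.
Let drift := young_const alpha + L1 / 2.

Let gap k w := f (x k w) - flow.

Let gap_ge0 k w : 0 <= gap k w. Proof. by rewrite subr_ge0. Qed.

Lemma has_expectation_inj (X : Omega -> R) a b :
  has_expectation P X a -> has_expectation P X b -> a = b.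
Proof. by move=> [_ ea] [_]; rewrite ea => -[]. Qed.

(** Both summands on the left of [gap_step_le] are nonnegative, so finiteness of
    the right-hand side makes each of them integrable. *)
Lemma gap_gradient_expectation k a b : has_expectation P (gap k) a ->
  has_expectation P (momentum_error f alpha x m k) b ->
  exists a' g, [/\ has_expectation P (gap k.+1) a',
    has_expectation P (gradient_norm f x k) g &
    a' + eta k * g <=
    a + (k.+1%:R `^ weight_exp alpha * eta k / 2 * b + drift * k.+1%:R^-1)].
Proof.
move=> ha hb.
have N1 : (1 : R) <= k.+1%:R by rewrite ler1n.
have := gap_step_le hf hG L10 halpha hlow hlip eta01 hx N1 (etaE k) ha hb.
set c := (X in (_ <= X%:E)%E) => hle.
have mgap := gap_measurable flow hf hG hx k.+1.
have mgrad := gradient_norm_measurable hf hG hx k.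
have grad0 w : 0 <= gradient_norm f x k w by exact: enorm_ge0.
have meg : measurable_fun [set: Omega] (fun w => eta k * gradient_norm f x k w).
  exact: measurable_funM.
have [a' ha' _] : exists2 a', has_expectation P (gap k.+1) a' & a' <= c.
  apply: ge0_has_expectation => //; apply: le_trans hle.
  apply: expectation_le => //; first exact: measurable_funD.
    by move=> w; rewrite addr_ge0 ?gap_ge0// mulr_ge0// ltW.
  by apply: aeW => w; rewrite lerDl mulr_ge0// ltW.
have [g hg _] : exists2 g, has_expectation P (fun w => eta k * gradient_norm f x k w) g
    & g <= c.
  apply: ge0_has_expectation => //; first by move=> w; rewrite mulr_ge0// ltW.
  apply: le_trans hle; apply: expectation_le => //; first exact: measurable_funD.
  - by move=> w; rewrite mulr_ge0// ltW.
  - by move=> w; rewrite addr_ge0 ?gap_ge0// mulr_ge0// ltW.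
  - by apply: aeW => w; rewrite lerDr gap_ge0.
exists a', ((eta k)^-1 * g); split => //.
  have := has_expectationZ (eta k)^-1 hg.
  by under eq_fun do rewrite mulKf ?gt_eqF//.
rewrite mulVKf ?gt_eqF// -lee_fin.
by have [_ <-] := has_expectationD ha' hg.
Qed.

Lemma gap_error_expectation k : exists a b,
  has_expectation P (gap k) a /\ has_expectation P (momentum_error f alpha x m k) b.
Proof.
elim: k => [|k [a [b [ha hb]]]].
  have [b hb _] := ge0_has_expectation (momentum_error_measurable alpha hf hG hx 0%N)
    (fun w => powR_ge0 _ _) (momentum_error0_le hG hvar hxi hx).
  exists (f x0 - flow), b; split=> //.
  have -> : gap 0%N = fun=> f x0 - flow.
    by apply/funext => w; rewrite /gap; have [-> _ _] := hx w.
  exact: has_expectation_cst.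
have [a' [_ [ha' _ _]]] := gap_gradient_expectation ha hb.
have [b' hb' _] := ge0_has_expectation (momentum_error_measurable alpha hf hG hx k.+1)
  (fun w => powR_ge0 _ _)
  (momentum_errorS_le hf hG L10 halpha hlip hmean hvar hsmooth eta01 hxi hx hb).
by exists a', b'.
Qed.

Lemma Malpha_ge2 : 2 <= Malpha alpha sigma L1 L (f x0) flow.
Proof.
rewrite /Malpha -/(young_const alpha).
have := young_const_ge1 a1 a2; have := powR_ge0 sigma alpha.
have := powR_ge0 L1 alpha; have := powR_ge0 L alpha.
have := hlow x0; have := L10; lra.
Qed.

(** The two expected recursions feed [potential_sum_le]; the harmonic sum is at
    most [1 + ln K <= 2 * ln K], which produces the factor [2] of [Malpha]. *)
Lemma weighted_gradient_sum_le : exists g : nat -> R,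
  (forall k, has_expectation P (gradient_norm f x k) (g k)) /\
  forall K, (3 <= K)%N -> \sum_(k < K) k.+1%:R `^ (- step_exp alpha) * g k <=
    Malpha alpha sigma L1 L (f x0) flow * ln K%:R.
Proof.
have [a /choice[b hab]] := choice gap_error_expectation.
have [ha hb] : (forall k, has_expectation P (gap k) (a k)) /\
    (forall k, has_expectation P (momentum_error f alpha x m k) (b k)).
  by split=> k; case: (hab k).
have /choice[g hg] k : exists g, has_expectation P (gradient_norm f x k) g /\
    a k.+1 + eta k * g <=
    a k + k.+1%:R `^ weight_exp alpha * eta k / 2 * b k + drift * k.+1%:R^-1.
  have [a' [g [ha' hg hle]]] := gap_gradient_expectation (ha k) (hb k).
  by exists g; split=> //; rewrite (has_expectation_inj (ha k.+1) ha') -addrA.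
exists g; split=> [k|K K3]; first by case: (hg k).
have b0 k : 0 <= b k.
  have [_ e] := hb k; rewrite -lee_fin -e; apply: expectation_ge0 => w.
  exact: powR_ge0.
have a0 k : 0 <= a k.
  by have [_ e] := ha k; rewrite -lee_fin -e; apply: expectation_ge0.
have aE : a 0%N = f x0 - flow.
  apply: (has_expectation_inj (ha 0%N)).
  have -> : gap 0%N = fun=> f x0 - flow.
    by apply/funext => w; rewrite /gap; have [-> _ _] := hx w.
  exact: has_expectation_cst.
have bE : b 0%N <= sigma `^ alpha.
  have [_ e] := hb 0%N; rewrite -lee_fin -e.
  exact: (momentum_error0_le hG hvar hxi hx).
have noise0 : 0 <= noise.
  by rewrite /noise addr_ge0 ?mulr_ge0 ?addr_ge0 ?powR_ge0.
have bS k : b k.+1 <= (1 - eta k) * b k + noise * eta k `^ alpha.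
  have := momentum_errorS_le hf hG L10 halpha hlip hmean hvar hsmooth eta01 hxi
    hx (hb k).
  by have [_ ->] := hb k.+1; rewrite lee_fin -mulrDl.
have := @potential_sum_le R alpha a1 a2 a b g drift noise b0 noise0 _ _ K.
rewrite aE => main.
have {main}: a K + K.+1%:R `^ weight_exp alpha * b K +
    \sum_(k < K) k.+1%:R `^ (- step_exp alpha) * g k <=
    f x0 - flow + b 0%N + (drift + 2 * noise) * \sum_(k < K) k.+1%:R^-1.
  by apply: main => k; rewrite -etaE; [have [] := hg k|exact: bS].
have K1 : (0 < K)%N by exact: leq_trans K3.
have lnK : 1 <= ln (K%:R : R).
  by apply: (le_trans ln3_ge1); rewrite ler_ln ?posrE ?ltr0n// ler_nat.
have pot0 : 0 <= a K + K.+1%:R `^ weight_exp alpha * b K.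
  by rewrite addr_ge0 ?mulr_ge0 ?powR_ge0.
have gap0 : 0 <= f x0 - flow by rewrite subr_ge0.
have yc := young_const_ge1 a1 a2.
have d0 : 0 <= drift + 2 * noise.
  by rewrite addr_ge0 ?mulr_ge0// /drift addr_ge0 ?divr_ge0//; lra.
have harmonic := ler_wpM2l d0 (@sum_inv_le_ln R K K1).
have ME : Malpha alpha sigma L1 L (f x0) flow =
    2 * (f x0 - flow + sigma `^ alpha + (drift + 2 * noise)).
  by rewrite /Malpha -/(young_const alpha) /drift /noise; ring.
have s0 := powR_ge0 sigma alpha.
rewrite ME.
(* [p] is the final potential, which is dropped because it is nonnegative *)
have combine (p S g0 b00 s T h l : R) : 0 <= p -> 0 <= g0 -> 0 <= s -> b00 <= s ->
    0 <= T -> 1 <= l -> T * h <= T * (1 + l) -> p + S <= g0 + b00 + T * h ->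
    S <= 2 * (g0 + s + T) * l.
  move=> p0 g00 sp bs T0 l1 Th pS.
  have : g0 + s <= (g0 + s) * l by rewrite ler_peMr ?addr_ge0.
  have : T <= T * l by rewrite ler_peMr.
  have : 0 <= (g0 + s) * l by rewrite mulr_ge0 ?addr_ge0//; lra.
  lra.
by apply: combine pot0 gap0 s0 bE d0 lnK harmonic.
Qed.

End WeightedGradientSum.

(** * The uniformly drawn index *)

Section UniformIndex.
Context {R : realType} {d : measure_display} {Omega : measurableType d}.
Variables (P : probability Omega R) (K : nat) (iota : {RV P >-> nat}).
Hypotheses (K0 : (0 < K)%N) (hunif : uniform_below P K iota).
Variables (H : nat -> Omega -> R) (g : nat -> R).
Hypothesis mH : forall i, measurable_fun [set: Omega] (H i).
Hypothesis H0 : forall i w, 0 <= H i w.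
Hypothesis hH : forall i, has_expectation P (H i) (g i).
Hypothesis indep : forall i (A : set nat) (B : set R), measurable A -> measurable B ->
  P (iota @^-1` A `&` H i @^-1` B) = (P (iota @^-1` A) * P (H i @^-1` B))%E.

Lemma measurable_random_index : measurable_fun [set: Omega] (fun w => H (iota w) w).
Proof.
move=> _ B mB; rewrite setTI.
have -> : (fun w => H (iota w) w) @^-1` B =
    \bigcup_i (iota @^-1` [set i] `&` H i @^-1` B).
  apply/seteqP; split=> [w /= Bw|w [i _ [/= <-]]//].
  by exists (iota w).
apply: bigcupT_measurable => i; apply: measurableI; first exact: measurable_funPTI.
by rewrite -[X in measurable X]setTI; exact: mH.
Qed.

Lemma measurable_index_eq i : measurable_fun [set: nat] (fun j => (j == i)%:R : R).
Proof. by []. Qed.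

(** The [K] values below [K] already carry the total mass. *)
Lemma ae_index_below : {ae P, forall w, (iota w < K)%N}.
Proof.
have mi i : measurable (iota @^-1` [set i]) by exact: measurable_funPTI.
exists (~` (iota @^-1` `I_K)); split => //.
- by apply: measurableC; exact: measurable_funPTI.
have -> : iota @^-1` `I_K = \big[setU/set0]_(i < K) iota @^-1` [set nat_of_ord i].
  by rewrite -(bigcup_mkord K (fun i => iota @^-1` [set i])) -preimage_bigcup
     bigcup_imset1 image_id.
rewrite probability_setC; last by apply: bigsetU_measurable.
have -> : P (\big[setU/set0]_(i < K) iota @^-1` [set nat_of_ord i]) =
    (\sum_(i < K) P (iota @^-1` [set nat_of_ord i]))%E.
  apply: (measure_semi_additive_ord_I P (F := fun i => iota @^-1` [set i])) => //.
    by move=> i j _ _ [w [/= -> ->]].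
  by apply: bigsetU_measurable.
rewrite (eq_bigr (fun=> (K%:R^-1)%:E)) => [|i _]; last exact: hunif.
rewrite sumEFin sumr_const card_ord -[_ *+ K]mulr_natr mulVf ?subee//.
by rewrite pnatr_eq0 -lt0n.
Qed.

Lemma expectation_at_index i : (i < K)%N ->
  (\int[P]_w ((iota w == i)%:R * H i w)%:E = (K%:R^-1 * g i)%:E)%E.
Proof.
move=> iK.
pose Z : {mfun Omega >-> R} := HB.pack (H i) (isMeasurableFun.Build _ _ _ _ _ (mH i)).
(* the absolute value makes the integrand nonnegative on all of [R] *)
pose Phi (p : nat * R) : \bar R := ((p.1 == i)%:R * `|p.2|)%:E.
have Phi0 p : (0 <= Phi p)%E by rewrite lee_fin mulr_ge0.
have mPhi : measurable_fun setT Phi.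
  apply/measurable_EFinP; apply: measurable_funM.
    exact: (measurableT_comp (measurable_index_eq i) measurable_fst).
  by apply: measurableT_comp => //; exact: measurable_snd.
have := integral_independent (Y := iota) (Z := Z) (D := distribution P Z)
  (fun _ _ => erefl) (indep i) mPhi Phi0.
have -> : (\int[P]_w Phi (iota w, Z w) = \int[P]_w ((iota w == i)%:R * H i w)%:E)%E.
  by apply: eq_integral => w _; rewrite /Phi /= ger0_norm.
move=> ->.
have inner w : (\int[distribution P Z]_z Phi (iota w, z) =
    (\1_(iota @^-1` [set i]) w)%:E * (g i)%:E)%E.
  under eq_integral do rewrite /Phi /= EFinM.
  have mabs : measurable_fun [set: R] (fun t : R => `|t|%:E).
    exact/measurable_EFinP.
  rewrite (ge0_integralZl (distribution P Z) measurableT mabs)//.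
  rewrite (ge0_integral_distribution Z mabs)//.
  congr (_ * _)%E; first rewrite indicE.
    by rewrite (_ : (w \in _) = (iota w == i))//; apply/idP/eqP; rewrite inE.
  have [_ <-] := hH i; rewrite unlock; apply: eq_integral => w' _ /=.
  by rewrite ger0_norm.
under eq_integral do rewrite inner.
rewrite ge0_integralZr//; last 2 first.
- by apply/measurable_EFinP; apply: measurable_indic; exact: measurable_funPTI.
- by have [_ <-] := hH i; exact: expectation_ge0.
rewrite integral_indic ?setIT ?EFinM//; last exact: measurable_funPTI.
by congr (_ * _)%E; exact: hunif.
Qed.

(** Almost surely exactly one of the indicators [iota w == i], [i < K], is one,
    and each of them is independent of [H i]. *)
Lemma expectation_uniform_index :
  'E_P[fun w => H (iota w) w]%E = (K%:R^-1 * \sum_(i < K) g i)%:E.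
Proof.
have mterm i : measurable_fun [set: Omega] (fun w => (iota w == i)%:R * H i w).
  apply: measurable_funM => //.
  exact: (measurableT_comp (measurable_index_eq i) (measurable_funPT iota)).
rewrite unlock; transitivity
  (\int[P]_w \sum_(i < K) ((iota w == i)%:R * H i w)%:E)%E.
  apply: ae_eq_integral => //.
    by apply/measurable_EFinP; exact: measurable_random_index.
    by apply: emeasurable_sum => i; apply/measurable_EFinP.
  case: ae_index_below => N [mN PN hN]; exists N; split => // w /= hw.
  apply: hN => /= iK; apply: hw => _.
  rewrite (bigD1 (Ordinal iK))//= eqxx mul1r big1 ?adde0// => j jK.
  rewrite (_ : (iota w == j) = false) ?mul0r//.
  by apply: contraNF jK => /eqP e; apply/eqP/val_inj.
rewrite ge0_integral_sum//; last 2 first.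
- by move=> i; apply/measurable_EFinP.
- by move=> i w _; rewrite lee_fin mulr_ge0.
under eq_bigr do rewrite expectation_at_index//.
by rewrite sumEFin -mulr_sumr.
Qed.

End UniformIndex.

(** * The complexity bound *)

Theorem theorem5 (R : realType) (n : nat)
  (d d' : measure_display) (Xi : measurableType d) (D : probability Xi R)
  (Omega : measurableType d') (P : probability Omega R)
  (f : 'rV[R]_n -> R) (G : 'rV[R]_n -> Xi -> 'rV[R]_n)
  (flow L1 sigma alpha L : R)
  (hf : continuously_differentiable f)
  (hopt : exists xs, forall x, f xs <= f x)
  (hG : jointly_measurable G)
  (hL1 : 0 < L1) (hsigma : 0 < sigma) (halpha : 1 < alpha <= 2) (hL : 0 < L)
  (hlow : bounded_below_by f flow)
  (hlip : lipschitz_gradient f L1)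
  (hmean : unbiased D f G)
  (hvar : central_moment_bound D f G alpha sigma)
  (hsmooth : weakly_average_smooth D G alpha L)
  (x0 : 'rV[R]_n) (eta theta : nat -> R)
  (heta : forall k, eta k = 1 / (k.+1%:R `^ (alpha / (2 * alpha - 1))))
  (htheta : forall k, theta k = 1 / (k.+1%:R `^ (alpha / (2 * alpha - 1))))
  (xi : nat -> {RV P >-> Xi}) (hxi : iid_samples D xi)
  (x m : nat -> Omega -> 'rV[R]_n)
  (hx : nsfom_rm G x0 eta theta xi x m)
  (hm : {ae P, forall w, forall k, m k w != 0})
  (eps : R) (heps : 0 < eps < 1)
  (K : nat)
  (hK : let M := Malpha alpha sigma L1 L (f x0) flow in
        let A := 2 * (2 * alpha - 1) * M / ((alpha - 1) * eps) in
        Num.max ((A * ln A) `^ ((2 * alpha - 1) / (alpha - 1))) 3 <= K%:R)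
  (iota : {RV P >-> nat})
  (hunif : uniform_below P K iota)
  (hindep : independent_of_family P iota xi) :
  ('E_P[fun w => (enorm (grad f (x (iota w) w)))%R] <= eps%:E)%E.
Proof.
have [a1 a2] := andP halpha.
have etaE k : eta k = k.+1%:R `^ (- step_exp alpha) by rewrite heta powRN div1r.
have thE : theta = eta by apply/funext => k; rewrite heta htheta.
rewrite thE in hx.
have [hKA K3] : (let A := 2 * (2 * alpha - 1) * Malpha alpha sigma L1 L (f x0) flow /
    ((alpha - 1) * eps) in
    (A * ln A) `^ ((2 * alpha - 1) / (alpha - 1)) <= K%:R) /\ (3 <= K)%N.
  by move: hK => /=; rewrite ge_max ler_nat => /andP[].
have K0 : (0 < K)%N by exact: leq_trans K3.
have L10 := ltW hL1.
have [g [hg hsum]] :=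
  weighted_gradient_sum_le hf hG L10 halpha hlow hlip hmean hvar hsmooth etaE hxi hx.
have grad0 i w : 0 <= gradient_norm f x i w by exact: enorm_ge0.
have g0 i : 0 <= g i.
  by have [_ e] := hg i; rewrite -lee_fin -e; exact: expectation_ge0.
have mgrad i := gradient_norm_measurable hf hG hx i.
have indep i (A : set nat) (B : set R) : measurable A -> measurable B ->
    P (iota @^-1` A `&` gradient_norm f x i @^-1` B) =
    (P (iota @^-1` A) * P (gradient_norm f x i @^-1` B))%E.
  move=> mA mB; apply: hindep => //; apply: (@past_sigma_generated _ _ _ _ _ _ _ i).
  have [mx _] := iterates_measurable_past hG i hx.
  have := measurable_enorm (measurableT_comp (measurable_grad hf) mx).
  by move=> /(_ measurableT B mB); rewrite setTI.
have -> : 'E_P[fun w => (enorm (grad f (x (iota w) w)))%R]%E =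
    (K%:R^-1 * \sum_(i < K) g i)%:E.
  exact: (expectation_uniform_index K0 hunif mgrad grad0 hg indep).
rewrite lee_fin mulrC ler_pdivrMr ?ltr0n// mulrC.
have M2 := Malpha_ge2 sigma L L10 halpha hlow x0.
exact: (average_le_of_large a1 a2 M2 heps hKA K3 g0 (hsum K K3)).
Qed.
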